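(* Let $N\in\mathbb{F}_q(t^p)[Y]$ be monic, irreducible and separable over $\mathbb{F}_q(t^p)$, let $\nu\in\mathbb{N}$, and let $L\in\mathbb{F}_q(t)\langle\partial\rangle$ be a monic (leading coefficient $1$) right divisor of $N(\partial^p)^\nu$. (1) If $N(\partial^p)$ is irreducible in $\mathbb{F}_q(t)\langle\partial\rangle$, then $L=N(\partial^p)^m$ for some $m\le\nu$, and $L$ is indecomposable. (2) Otherwise, let $N^{\nu_1}\mid N^{\nu_2}\mid\cdots\mid N^{\nu_k}$ be the Frobenius invariants of $\psi_p^L$. Then there exist $L_1,\dots,L_k\in\mathbb{F}_q(t)\langle\partial\rangle$ such that (i) $L=\mathrm{LCLM}(L_1,\dots,L_k)$ and $\operatorname{ord}L=\sum_{i=1}^k\operatorname{ord}L_i$; (ii) $\operatorname{ord}L_i=\nu_i\deg N$ for all $i$; (iii) each $L_i$ is indecomposable.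
   Context: Let $p$ be a prime, $q=p^n$. $\mathbb{F}_q(t)\langle\partial\rangle$ is the ring of linear differential operators with coefficients in $\mathbb{F}_q(t)$, multiplication given by $\partial f=f\partial+\frac{df}{dt}$; $\operatorname{ord}$ is the order in $\partial$. $\mathrm{LCLM}(L_1,\dots,L_k)$ generates $\bigcap_i\mathbb{F}_q(t)\langle\partial\rangle L_i$ and $\mathrm{GCRD}(L_1,L_2)$ generates $\mathbb{F}_q(t)\langle\partial\rangle L_1+\mathbb{F}_q(t)\langle\partial\rangle L_2$ (up to left multiplication by nonzero elements of $\mathbb{F}_q(t)$); $L_1,L_2$ are coprime if their GCRD is $1$. $L$ is decomposable if $L=\mathrm{LCLM}(L_1,L_2)$ for some coprime $L_1,L_2$ of positive order, and indecomposable otherwise. $\mathcal{D}_L:=\mathbb{F}_q(t)\langle\partial\rangle/\mathbb{F}_q(t)\langle\partial\rangle L$. The $p$-curvature $\psi_p^L$ is the $\mathbb{F}_q(t)$-linear endomorphism of $\mathcal{D}_L$ given by left multiplication by $\partial^p$. The Frobenius invariants of an endomorphism $\psi$ of a finite-dimensional vector space $V$ are its nonconstant monic invariant factors $P_1\mid\cdots\mid P_m$, i.e. $V\simeq\bigoplus_i \mathbb{F}_q(t)[Y]/(P_i)$ as $\mathbb{F}_q(t)[Y]$-modules with $Y$ acting by $\psi$; for $\psi_p^L$ they lie in $\mathbb{F}_q(t^p)[Y]$. For $P\in\mathbb{F}_q(t^p)[Y]$, $P(\partial^p)$ is the (central) operator obtained by substituting $\partial^p$ for $Y$. *)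

(* Defs.v *)
From HB Require Import structures.
From mathcomp Require Import all_boot all_order all_algebra.
From mathcomp Require Import generic_quotient fraction separable.
Set Implicit Arguments. Unset Strict Implicit. Unset Printing Implicit Defensive.
Import Order.TTheory GRing.Theory.
Local Open Scope ring_scope.

(* Conventions.
   F : finite field F_q (of characteristic p).
   Kt F := F_q(t), realised as the fraction field of {poly F} ('X plays t).
   A differential operator  sum_i a_i d^i  (a_i in F_q(t)) is represented by
   the polynomial  sum_i a_i 'X^i : {poly Kt F}  (coefficients on the left);
   its product is the skew product [mulD] below (d f = f d + f'). *)

Section DiffOps.
Variable F : finFieldType.

Definition Kt := {fraction {poly F}}.

Definition tofracF (a : {poly F}) : Kt := FracField.tofrac a.

(* d/dt on F_q(t), computed from any representative a/b (the value does not
   depend on the chosen representative). *)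
Definition dt (x : Kt) : Kt :=
  let r := repr x in
  tofracF ((\n_r)^`() * \d_r - \n_r * (\d_r)^`()) / tofracF (\d_r ^+ 2).

(* The embedding F_q(s) -> F_q(t), s |-> t^p, whose image is F_q(t^p);
   computed from any representative. *)
Definition frobT (p : nat) (x : Kt) : Kt :=
  let r := repr x in tofracF (\n_r \Po 'X^p) / tofracF (\d_r \Po 'X^p).

Definition Dop := {poly Kt}.

Definition mulD (A B : Dop) : Dop :=
  \sum_(i < size A) \sum_(k < i.+1) \sum_(j < size B)
     (A`_i * ('C(i, k))%:R * iter k dt B`_j) *: 'X^(i - k + j).

Definition expD (A : Dop) (n : nat) : Dop := iter n (mulD A) 1.

Definition ord (A : Dop) : nat := (size A).-1.

Definition inLideal (L X : Dop) : Prop := exists A : Dop, X = mulD A L.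

Definition rdvd (L M : Dop) : Prop := inLideal L M.

Definition is_LCLM (M : Dop) (k : nat) (Ls : 'I_k -> Dop) : Prop :=
  forall X : Dop, (forall i, inLideal (Ls i) X) <-> inLideal M X.

Definition is_GCRD (G L1 L2 : Dop) : Prop :=
  forall X : Dop, (exists A B : Dop, X = mulD A L1 + mulD B L2) <-> inLideal G X.

Definition coprimeD (L1 L2 : Dop) : Prop := is_GCRD 1 L1 L2.

Definition decomposable (L : Dop) : Prop :=
  exists L1 L2 : Dop, [/\ coprimeD L1 L2, (0 < ord L1)%N, (0 < ord L2)%N &
     is_LCLM L (fun i : 'I_2 => if val i == 0%N then L1 else L2)].

Definition indecomposable (L : Dop) : Prop := ~ decomposable L.

Definition irreducibleD (M : Dop) : Prop :=
  (0 < ord M)%N /\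
  forall A B : Dop, M = mulD A B -> (ord A = 0)%N \/ (ord B = 0)%N.

Definition evalDp (p : nat) (a : {poly Kt}) : Dop := a \Po 'X^p.

(* Frobenius invariants of the p-curvature of L: the K[Y]-module D_L = D/DL,
   with Y acting by left multiplication by d^p, is isomorphic to
   (+)_i K[Y]/(P_i), with P_i monic nonconstant and P_1 | ... | P_k.
   The isomorphism is given by generators v_i : the K[Y]-linear map
   K[Y]^k -> D_L, (a_i) |-> sum_i a_i(d^p) v_i mod DL, is onto and its kernel is
   exactly (+)_i (P_i). *)
Definition frob_invariants (p : nat) (L : Dop) (k : nat) (P : 'I_k -> {poly Kt})
  : Prop :=
  [/\ forall i, P i \is monic,
      forall i, (1 < size (P i))%N,
      forall i j : 'I_k, (i <= j)%N -> P i %| P j &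
      exists v : 'I_k -> Dop,
        (forall B : Dop, exists a : 'I_k -> {poly Kt},
            inLideal L (B - \sum_i mulD (evalDp p (a i)) (v i))) /\
        (forall a : 'I_k -> {poly Kt},
            inLideal L (\sum_i mulD (evalDp p (a i)) (v i)) <->
            (forall i, P i %| a i))].

End DiffOps.

(* Main.v *)
(* Write K = F_q(t), let D = K<d>, and let z = N(d^p), which is central in D; K[Y] acts on D with Y acting as d^p, and on D it is just commutative multiplication by a(d^p). If z is irreducible, GCRD(L, z) is z or 1, and z is split off L until nothing remains.

   Otherwise the simple D/Dz-modules have dimension one over the field K[Y]/N: a proper right divisor of d^p - Y over K[Y]/N of least order b has b | p, because D/Dz is simple and d^p - Y is a least common left multiple of conjugates of that divisor, so b = 1. This gives f with (d + f)^p 1 = Y modulo N, and f lifts modulo N^nu. Twisting D/DL by -f makes its p-curvature vanish, so by Cartier descent its horizontal elements span it; by an exchange argument the given generators of the K[Y]-module D/DL can be replaced by horizontal ones w_i. Then K[Y] w_i is a D-submodule, and L_i is the annihilator of the i-th component of 1. It is indecomposable because its submodules are submodules of K[Y]/N^nu_i, which has a simple socle. *)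
Require Import Defs.
From HB Require Import structures.
From mathcomp Require Import all_boot all_order all_algebra.
From mathcomp Require Import generic_quotient fraction separable.
From mathcomp Require Import qpoly qfpoly.
From mathcomp Require Import ring zify.
From Stdlib Require Import Classical_Prop Classical_Pred_Type.
Set Implicit Arguments. Unset Strict Implicit. Unset Printing Implicit Defensive.
Import GRing.Theory.
Local Open Scope ring_scope.

(** * The derivation and the Frobenius on F_q(t) *)

(** D is an Azumaya algebra of rank p^2 over its centre, so D/Dz is central simple of degree p,
    hence a division algebra or a matrix algebra; this is the dichotomy of the theorem, and the
    divisibility b | p is an elementary substitute for Wedderburn's theorem. Separability keeps N
    irreducible over F_q(t), and its coefficients are constants there, so K[Y]/N is a field with a
    derivation. The lift of f from N to N^nu works because the p-curvature of d + f is additive in f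
    and horizontal: each error is a constant times a power of N, and d^(p-1) h = constant is
    solvable. As f is a scalar in K[Y]/N^nu, one twist serves all summands at once. *)

Section RationalFunctions.
Variable F : finFieldType.
Local Notation K := (Kt F).
Local Notation "a %:F" := (@FracField.tofrac {poly F} a).

Lemma Kt_reprE (x : K) :
  x = (\n_(repr x))%:F / (\d_(repr x))%:F.
Proof.
set r := repr x; have d0 : \d_r != 0 := denom_ratioP r.
have dF : (\d_r)%:F != 0 by rewrite tofrac_eq0.
apply: (mulIf dF); rewrite divfK // -[x]reprK -/r.
unlock FracField.tofrac; rewrite -[LHS]FracField.pi_mul.
apply/eqP; rewrite FracField.equivf_def /FracField.mulf.
by rewrite !numden_Ratio ?mulr1 ?oner_neq0 // mulrC.
Qed.

Lemma Kt_ind (P : K -> Prop) :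
  (forall a b : {poly F}, b != 0 -> P (a%:F / b%:F)) -> forall x, P x.
Proof. by move=> H x; rewrite (Kt_reprE x); apply: H; apply: denom_ratioP. Qed.

Lemma frac_eq (a b n d : {poly F}) : b != 0 -> d != 0 ->
  a%:F / b%:F = n%:F / d%:F :> K -> a * d = n * b.
Proof.
move=> b0 d0 /eqP; rewrite eqr_div ?tofrac_eq0 //.
by rewrite -!tofracM tofrac_eq => /eqP.
Qed.

(** Independence of the representative chosen by [repr]: the relation a d = n b and its derivative
    are substituted into the cross-multiplied quotient rules. *)
Lemma dt_frac (a b : {poly F}) : b != 0 ->
  dt (a%:F / b%:F) = (a^`() * b - a * b^`())%:F / (b ^+ 2)%:F.
Proof.
move=> b0; rewrite /dt /tofracF.
have := Kt_reprE (a%:F / b%:F); have := denom_ratioP (repr (a%:F / b%:F)).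
set r := repr _; move: (frac r).1 (frac r).2 => n d d0 {r} E.
have {}E := frac_eq b0 d0 E.
have dE := congr1 (@deriv F) E; rewrite !derivM in dE.
apply/eqP; rewrite eqr_div ?tofrac_eq0 ?expf_neq0 //.
rewrite -!tofracM tofrac_eq; apply/eqP.
have -> : (n^`() * d - n * d^`()) * b ^+ 2 = (n^`() * b + n * b^`()) * (d * b) - (n * b) * (b^`() * d + b * d^`()) by ring.
rewrite -dE -E; ring.
Qed.

Lemma frobT_frac p (a b : {poly F}) : (0 < p)%N -> b != 0 ->
  frobT p (a%:F / b%:F) = (a \Po 'X^p)%:F / (b \Po 'X^p)%:F.
Proof.
move=> p0 b0; rewrite /frobT /tofracF.
have := Kt_reprE (a%:F / b%:F); have := denom_ratioP (repr (a%:F / b%:F)).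
set r := repr _; move: (frac r).1 (frac r).2 => n d d0 {r} E.
have {}E := frac_eq b0 d0 E.
have c0 (c : {poly F}) : c != 0 -> c \Po 'X^p != 0.
  by move=> ?; rewrite comp_poly_eq0 // size_polyXn.
apply/eqP; rewrite eqr_div ?tofrac_eq0 ?c0 //.
by rewrite -!tofracM tofrac_eq -!comp_polyM E.
Qed.

Lemma Kt_ind2 (P : K -> K -> Prop) :
  (forall a b c d : {poly F}, b != 0 -> d != 0 ->
     P (a%:F / b%:F) (c%:F / d%:F)) -> forall x y, P x y.
Proof. by move=> H; elim/Kt_ind=> a b b0; elim/Kt_ind=> c d d0; apply: H. Qed.

Lemma frac_subE (a b c d : {poly F}) : b != 0 -> d != 0 ->
  a%:F / b%:F - c%:F / d%:F = (a * d - c * b)%:F / (b * d)%:F :> K.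
Proof.
move=> b0 d0; rewrite -mulNr addf_div ?tofrac_eq0 //.
by rewrite mulNr -!tofracM -tofracB.
Qed.

Lemma frac_mulE (a b c d : {poly F}) :
  (a%:F / b%:F) * (c%:F / d%:F) = (a * c)%:F / (b * d)%:F :> K.
Proof. by rewrite mulf_div -!tofracM. Qed.

Lemma eq_frac (a b c d : {poly F}) : b != 0 -> d != 0 ->
  a * d = c * b -> a%:F / b%:F = c%:F / d%:F :> K.
Proof.
move=> b0 d0 E; apply/eqP; rewrite eqr_div ?tofrac_eq0 //.
by rewrite -!tofracM E.
Qed.

Lemma dt_is_zmod_morphism : zmod_morphism (@dt F).
Proof.
apply: Kt_ind2 => a b c d b0 d0.
rewrite frac_subE // !dt_frac ?mulf_neq0 // frac_subE ?expf_neq0 //.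
apply: eq_frac; rewrite ?mulf_neq0 ?expf_neq0 ?mulf_neq0 //.
rewrite !derivE; ring.
Qed.

HB.instance Definition _ :=
  GRing.isZmodMorphism.Build K K (@dt F) dt_is_zmod_morphism.

Lemma dtM (x y : K) : dt (x * y) = dt x * y + x * dt y.
Proof.
suff H : dt (x * y) - dt x * y = x * dt y by rewrite -H addrC subrK.
move: x y; apply: Kt_ind2 => a b c d b0 d0.
rewrite frac_mulE !dt_frac ?mulf_neq0 // !frac_mulE.
rewrite frac_subE ?mulf_neq0 ?expf_neq0 ?mulf_neq0 //.
apply: eq_frac; rewrite ?mulf_neq0 ?expf_neq0 ?mulf_neq0 //.
rewrite !derivE; ring.
Qed.

Lemma dt_tofrac (a : {poly F}) : dt a%:F = (a^`())%:F :> K.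
Proof.
have := @dt_frac a 1 (oner_neq0 _).
by rewrite tofrac1 expr1n tofrac1 !divr1 derivC mulr0 subr0 mulr1.
Qed.

Section Char.
Variable p : nat.
Hypothesis Hp : p \in [pchar F].

Let p_prime : prime p := pcharf_prime Hp.
Let p_gt0 : (0 < p)%N := prime_gt0 p_prime.

Lemma pchar_Kt : p \in [pchar K].
Proof.
have pF : p \in [pchar {poly F}] by rewrite pchar_poly.
by apply: (rmorph_pchar (@FracField.tofrac {poly F} : {rmorphism {poly F} -> K})).
Qed.

Lemma frobT_morph : exists phi : {rmorphism K -> K}, phi =1 frobT p.
Proof.
have frob_zmod : zmod_morphism (@frobT F p).
  apply: Kt_ind2 => a b c d b0 d0.
  have c0 (e : {poly F}) : e != 0 -> e \Po 'X^p != 0.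
    by move=> ?; rewrite comp_poly_eq0 // size_polyXn.
  rewrite frac_subE // !frobT_frac ?mulf_neq0 // frac_subE ?c0 //.
  by rewrite comp_polyB !comp_polyM.
have frob_monoid : monoid_morphism (@frobT F p).
  split=> [|x y].
    have := @frobT_frac p 1 1 p_gt0 (oner_neq0 _).
    by rewrite comp_polyC tofrac1 divr1.
  move: x y; apply: Kt_ind2 => a b c d b0 d0.
  rewrite frac_mulE !frobT_frac ?mulf_neq0 // frac_mulE.
  by rewrite !comp_polyM.
pose f1 := GRing.isZmodMorphism.Build K K (frobT p) frob_zmod.
pose f2 := GRing.isMonoidMorphism.Build K K (frobT p) frob_monoid.
pose phi : {rmorphism K -> K} := HB.pack (@frobT F p) f1 f2.
by exists phi.
Qed.

Lemma deriv_comp_Xp (a : {poly F}) : (a \Po 'X^p)^`() = 0.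
Proof.
rewrite deriv_comp derivXn.
have -> : 'X^(p.-1) *+ p = 0 :> {poly F}.
  by rewrite -mulr_natr pcharf0 ?mulr0 // pchar_poly.
by rewrite mulr0.
Qed.

Lemma dt_frobT (x : K) : dt (frobT p x) = 0.
Proof.
move: x; apply: Kt_ind => a b b0.
have c0 : b \Po 'X^p != 0 by rewrite comp_poly_eq0 // size_polyXn.
rewrite frobT_frac // dt_frac // !deriv_comp_Xp.
by rewrite mul0r mulr0 subr0 tofrac0 mul0r.
Qed.

(** This makes p-th powers constants for the derivation, in [iter_dt_p], and puts them in the image
    of [frobT], in [expp_frobT]. *)
Lemma expp_comp (a : {poly F}) :
  a ^+ p = map_poly (pFrobenius_aut Hp) a \Po 'X^p.
Proof.
have pP : p \in [pchar {poly F}] by rewrite pchar_poly.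
elim/poly_ind: a => [|a c IH].
  by rewrite expr0n gtn_eqF // map_poly0 comp_poly0.
rewrite -(pFrobenius_autE pP) rmorphD rmorphM /= !pFrobenius_autE IH.
rewrite rmorphD rmorphM /= map_polyX map_polyC /= comp_polyD comp_polyM.
by rewrite comp_polyX comp_polyC pFrobenius_autE polyC_exp.
Qed.

Lemma expp_frobT (x : K) : exists y, x ^+ p = frobT p y.
Proof.
move: x; apply: Kt_ind => a b b0.
exists ((map_poly (pFrobenius_aut Hp) a)%:F / (map_poly (pFrobenius_aut Hp) b)%:F).
rewrite frobT_frac // ?map_poly_eq0 // -!expp_comp.
by rewrite !tofracXn -exprVn exprMn_comm //; apply: mulrC.
Qed.

Lemma iter_deriv_p (a : {poly F}) : iter p (@deriv F) a = 0.
Proof.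
rewrite -/(derivn p a) nderivn_def -mulr_natr.
have : (p`!)%:R = 0 :> {poly F}.
  apply/eqP; rewrite -(dvdn_pcharf (_ : p \in [pchar {poly F}])) ?pchar_poly //.
  by rewrite dvdn_fact // p_gt0 leqnn.
by move=> ->; rewrite mulr0.
Qed.

Lemma iter_dt_p (x : K) : iter p (@dt F) x = 0.
Proof.
move: x; apply: Kt_ind => a b b0.
(* A p-th power in the denominator is a constant, so all p derivations fall on the numerator. *)
have -> : a%:F / b%:F = (a * b ^+ p.-1)%:F / (b ^+ p)%:F :> K.
  by apply: eq_frac; rewrite ?expf_neq0 // -mulrA -exprSr prednK.
move: (a * _) => {}a.
have H n : iter n (@dt F) (a%:F / (b ^+ p)%:F) = (iter n (@deriv F) a)%:F / (b ^+ p)%:F.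
  elim: n => //= n ->; rewrite dt_frac ?expf_neq0 //.
  apply: eq_frac; rewrite ?expf_neq0 //.
  rewrite expp_comp deriv_comp_Xp mulr0 subr0; ring.
by rewrite H iter_deriv_p tofrac0 mul0r.
Qed.

Lemma dtX : dt ('X%:F : K) = 1.
Proof. by rewrite dt_tofrac derivX tofrac1. Qed.

(* If P divides N over F_q(t) then P^p has coefficients in F_q(t^p) and is not coprime to N there, so N divides P^p; separability leaves only N = P. *)
Lemma frobT_poly (N : {poly K}) : N \is monic -> irreducible_poly N ->
  separable_poly N ->
  exists M : {poly K}, [/\ M \is monic, irreducible_poly M, map_poly (@dt F) M = 0,
    size M = size N & forall n, map_poly (frobT p) (N ^+ n) = M ^+ n].
Proof.
move=> Nmon Nirr Nsep; have [phi phiE] := frobT_morph.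
have mapE A : map_poly (frobT p) A = map_poly phi A by apply: eq_map_poly => x; rewrite phiE.
exists (map_poly phi N); split.
- by rewrite map_monic.
- split; first by rewrite size_map_poly; case: Nirr.
  move=> P P1 PN.
  have [Q PQ] : exists Q, P ^+ p = map_poly phi Q.
    have pK : p \in [pchar {poly K}] by rewrite pchar_poly pchar_Kt.
    elim/poly_ind: P {P1 PN} => [|P c [Q IH]].
      by exists 0; rewrite rmorph0 expr0n gtn_eqF.
    have [y cy] := expp_frobT c.
    exists (Q * 'X^p + y%:P).
    rewrite rmorphD rmorphM /= map_polyXn map_polyC /= phiE -cy -IH.
    by rewrite -(pFrobenius_autE pK) rmorphD rmorphM /= !pFrobenius_autE polyC_exp.
  have N0 : N != 0 by rewrite monic_neq0.
  have P0 : P != 0 by apply: contraTneq PN => ->; rewrite dvd0p map_poly_eq0.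
  have NQ : N %| Q.
    apply: contraT => NQ.
    have : coprimep (map_poly phi N) (map_poly phi Q).
      by rewrite coprimep_map irreducible_poly_coprime.
    rewrite -PQ => /coprimepP /(_ P PN); rewrite dvdp_exp // => /(_ isT).
    rewrite -size_poly_eq1.
    by rewrite (negbTE P1).
  have NP : map_poly phi N %| P ^+ p by rewrite PQ dvdp_map.
  rewrite /eqp PN /=.
  have [R NR] := dvdpP _ _ PN.
  have copRP : coprimep R P.
    have : separable_poly (map_poly phi N) by rewrite separable_map.
    by rewrite NR => /separable_polyP [/(_ R P) H _]; apply: H.
  have : R %| P ^+ p by apply: dvdp_trans NP; rewrite NR dvdp_mulr.
  rewrite -[P ^+ p]mulr1 Gauss_dvdpr ?coprimep_expr // dvdp1 => /eqP R1.
  rewrite NR; have /size_poly1P[c c0 ->] : size R == 1 by rewrite R1.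
  by rewrite mul_polyC dvdpZl.
- by apply/polyP=> i; rewrite !coef_map /= phiE dt_frobT coef0.
- by rewrite size_map_poly.
- by move=> n; rewrite mapE rmorphXn.
Qed.

End Char.
End RationalFunctions.

(** * Differential operators over a differential ring *)

Section Leibniz.
Variables (U V W : Type) (X : zmodType).
Variables (DU : U -> U) (DV : V -> V) (D : {additive X -> X}) (b : U -> V -> X).
Hypothesis bD : forall u v, D (b u v) = b (DU u) v + b u (DV v).

(** The pairing is abstract because the formula serves for products of polynomials, tensor products
    of connections and scalar multiplication. *)
Lemma leibniz n u v :
  iter n D (b u v) = \sum_(k < n.+1) b (iter k DU u) (iter (n - k) DV v) *+ 'C(n, k).
Proof.
elim: n => [|n IH]; first by rewrite big_ord1 mulr1n.
rewrite iterS IH raddf_sum /=.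
have step (k : 'I_n.+1) : D (b (iter k DU u) (iter (n - k) DV v) *+ 'C(n, k)) =
    b (iter k.+1 DU u) (iter (n - k) DV v) *+ 'C(n, k)
    + b (iter k DU u) (iter (n.+1 - k) DV v) *+ 'C(n, k).
  by rewrite raddfMn bD mulrnDl subSn // -ltnS.
under eq_bigr => k _ do rewrite step.
rewrite big_split [RHS]big_ord_recl /=.
under [in RHS]eq_bigr => k _ do rewrite /bump /= add1n binS mulrnDr subSS.
rewrite big_split /= addrA addrC; congr (_ + _).
rewrite big_ord_recl [X in _ = _ + X]big_ord_recr /= (@bin_small n n.+1) // mulr0n addr0.
by rewrite !bin0.
Qed.

(** Only the two extreme binomial coefficients survive modulo p; the additivity of p-curvatures
    comes from here. *)
Lemma leibniz_pchar p u v : prime p -> (forall x : X, x *+ p = 0) ->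
  iter p D (b u v) = b (iter p DU u) v + b u (iter p DV v).
Proof.
move=> p_pr Xp; rewrite leibniz; case: p p_pr Xp => // p p_pr Xp.
rewrite big_ord_recr big_ord_recl /= !bin0 binn ?subn0 subnn !mulr1n.
rewrite big1 ?addr0 1?addrC // => k _.
have /dvdnP[m ->] : (p.+1 %| 'C(p.+1, bump 0 k))%N.
  by rewrite prime_dvd_bin // /bump /= add1n ltnS ltn_ord.
by rewrite mulrnA Xp.
Qed.

End Leibniz.

Section SkewRing.
Variables (R : comNzRingType) (d : {additive R -> R}).
Hypothesis dM : forall x y, d (x * y) = d x * y + x * d y.

Implicit Types (A B C : {poly R}).

Definition pder (A : {poly R}) : {poly R} := map_poly d A.

Lemma coef_pder A i : (pder A)`_i = d A`_i.
Proof. by rewrite coef_map. Qed.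

Lemma pder_is_zmod_morphism : zmod_morphism pder.
Proof. by move=> A B; apply/polyP=> i; rewrite !(coef_pder, coefB) raddfB. Qed.

HB.instance Definition _ :=
  GRing.isZmodMorphism.Build _ _ pder pder_is_zmod_morphism.

Lemma pderM A B : pder (A * B) = pder A * B + A * pder B.
Proof.
apply/polyP=> i; rewrite coef_pder coefD !coefM raddf_sum -big_split /=.
by apply: eq_bigr => j _; rewrite dM !coef_pder.
Qed.

Lemma pderC c : pder c%:P = (d c)%:P. Proof. exact: map_polyC. Qed.

Lemma der1 : d 1 = 0.
Proof.
by have := dM 1 1; rewrite !mulr1 mul1r => /(canLR (addrK _)); rewrite subrr.
Qed.

Lemma pderXn n : pder 'X^n = 0.
Proof.
by apply/polyP=> i; rewrite coef_pder coefXn coef0; case: eqP; rewrite ?der1 ?raddf0.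
Qed.

Lemma pderX : pder 'X = 0. Proof. by rewrite -['X]expr1 pderXn. Qed.

Lemma pder1 : pder 1 = 0. Proof. by rewrite -[1]/('X^0) pderXn. Qed.

Section Action.
Variables (V : lmodType R) (D : {additive V -> V}).
Hypothesis DZ : forall c v, D (c *: v) = d c *: v + c *: D v.

Implicit Types (u v : V).

(** The module over the operator ring in which d acts as D. The ring itself, with D := [dop], gives
    the product [omul], whose associativity is then a case of [act_omul]. *)
Definition act (A : {poly R}) (v : V) : V := \sum_(i < size A) A`_i *: iter i D v.

Lemma act_widen n A v : (size A <= n)%N ->
  act A v = \sum_(i < n) A`_i *: iter i D v.
Proof.
move=> le_n; rewrite /act (big_ord_widen n (fun i => A`_i *: iter i D v) le_n).
rewrite big_mkcond; apply: eq_bigr => i _.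
by case: ltnP => // /(nth_default 0) ->; rewrite scale0r.
Qed.

Lemma iterD_B n : {morph iter n D : u v / u - v}.
Proof. by elim: n => // n IH u v; rewrite !iterS IH raddfB. Qed.

Lemma iterD_D n : {morph iter n D : u v / u + v}.
Proof. by elim: n => // n IH u v; rewrite !iterS IH raddfD. Qed.

Lemma actDr A u v : act A (u + v) = act A u + act A v.
Proof. by rewrite -big_split; apply: eq_bigr => i _; rewrite iterD_D scalerDr. Qed.

Lemma actBr A u v : act A (u - v) = act A u - act A v.
Proof. by apply/eqP; rewrite eq_sym subr_eq -actDr subrK. Qed.

Lemma act0r A : act A 0 = 0.
Proof. by apply: (addrI (act A 0)); rewrite -actDr !addr0. Qed.

Lemma act_sumr A (I : Type) (r : seq I) (P : pred I) (f : I -> V) :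
  act A (\sum_(i <- r | P i) f i) = \sum_(i <- r | P i) act A (f i).
Proof. exact: (big_morph (act A) (@actDr A) (act0r A)). Qed.

Lemma actDl A B v : act (A + B) v = act A v + act B v.
Proof.
pose n := maxn (size A) (size B).
rewrite !(@act_widen n) ?leq_maxl ?leq_maxr ?size_polyD // -big_split /=.
by apply: eq_bigr => i _; rewrite coefD scalerDl.
Qed.

Lemma actZl c A v : act (c *: A) v = c *: act A v.
Proof.
rewrite (@act_widen (size A)) ?size_scale_leq // scaler_sumr.
by apply: eq_bigr => i _; rewrite coefZ scalerA.
Qed.

Lemma act0l v : act 0 v = 0.
Proof. by rewrite /act size_poly0 big_ord0. Qed.

Lemma actBl A B v : act (A - B) v = act A v - act B v.
Proof. by rewrite -[- B]scaleN1r actDl actZl scaleN1r. Qed.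

Lemma actC c v : act c%:P v = c *: v.
Proof. by rewrite (@act_widen 1) ?size_polyC_leq1 // big_ord1 coefC eqxx. Qed.

Lemma act1 v : act 1 v = v.
Proof. by rewrite actC scale1r. Qed.

Lemma actXn n v : act 'X^n v = iter n D v.
Proof.
rewrite (@act_widen n.+1) ?size_polyXn // big_ord_recr /= coefXn eqxx scale1r.
by rewrite big1 ?add0r // => i _; rewrite coefXn ltn_eqF // scale0r.
Qed.

Lemma act_suml (I : Type) (r : seq I) (P : pred I) (f : I -> {poly R}) v :
  act (\sum_(i <- r | P i) f i) v = \sum_(i <- r | P i) act (f i) v.
Proof. exact: (big_morph (act^~ v) (fun A B => actDl A B v) (act0l v)). Qed.

End Action.

(* The product of the operator d with A. *)
Definition dop (A : {poly R}) : {poly R} := pder A + A * 'X.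

Lemma dop_is_zmod_morphism : zmod_morphism dop.
Proof. by move=> A B; rewrite /dop raddfB mulrBl opprD addrACA. Qed.

HB.instance Definition _ :=
  GRing.isZmodMorphism.Build _ _ dop dop_is_zmod_morphism.

Lemma dopM A B : dop (A * B) = pder A * B + A * dop B.
Proof. by rewrite /dop pderM mulrDr addrA mulrA. Qed.

Lemma dopZ c A : dop (c *: A) = d c *: A + c *: dop A.
Proof. by rewrite -!mul_polyC dopM pderC. Qed.

Definition omul (A B : {poly R}) : {poly R} := act dop A B.

Lemma omulZl c A B : omul (c *: A) B = c *: omul A B.
Proof. exact: actZl. Qed.

Lemma omul1l B : omul 1 B = B. Proof. exact: act1. Qed.

Lemma iter_dop1 n : iter n dop 1 = 'X^n.
Proof. by elim: n => // n IH; rewrite iterS IH /dop pderXn add0r -exprSr. Qed.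

Lemma omul1r A : omul A 1 = A.
Proof.
rewrite /omul /act; under eq_bigr => i _ do rewrite iter_dop1.
by rewrite -poly_def coefK.
Qed.

Section ActMul.
Variables (V : lmodType R) (D : {additive V -> V}).
Hypothesis DZ : forall c v, D (c *: v) = d c *: v + c *: D v.

Implicit Types (v : V).

Lemma act_dop A v : act D (dop A) v = D (act D A v).
Proof.
rewrite /dop actDl [act D A v]/act raddf_sum /=.
under eq_bigr => i _ do rewrite DZ.
rewrite big_split /=; congr (_ + _).
  rewrite (@act_widen _ _ (size A)) ?size_poly //.
  by apply: eq_bigr => i _; rewrite coef_pder.
rewrite (@act_widen _ _ (size A).+1); last first.
  by rewrite (leq_trans (size_polyMleq _ _)) // size_polyX addnS addn1.
rewrite big_ord_recl coefMX /= scale0r add0r.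
by apply: eq_bigr => i _; rewrite coefMX /= -iterS.
Qed.

Lemma act_iter_dop n A v : act D (iter n dop A) v = iter n D (act D A v).
Proof. by elim: n => // n IH; rewrite !iterS act_dop IH. Qed.

Lemma act_omul A B v : act D (omul A B) v = act D A (act D B v).
Proof.
rewrite /omul [act dop A B]/act act_suml; apply: eq_bigr => i _.
by rewrite actZl act_iter_dop.
Qed.

End ActMul.

Lemma omulA A B C : omul A (omul B C) = omul (omul A B) C.
Proof. by rewrite /omul act_omul //; apply: dopZ. Qed.

Lemma iter_dop n B :
  iter n dop B = \sum_(k < n.+1) (iter k pder B * 'X^(n - k)) *+ 'C(n, k).
Proof.
rewrite -{1}[B]mulr1 (@leibniz _ _ _ pder dop _ (fun u v => u * v)); last exact: dopM.
by apply: eq_bigr => k _; rewrite iter_dop1.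
Qed.

(** Coefficients killed by d commute with the operator d, so nothing is left of the skewness. *)
Lemma omul_hor A B : pder B = 0 -> omul A B = A * B.
Proof.
move=> dB; rewrite /omul /act -[in RHS](coefK A) poly_def mulr_suml.
apply: eq_bigr => i _; rewrite -scalerAl; congr (_ *: _).
elim: (val i) => [|n IH]; first by rewrite mul1r.
rewrite iterS IH /= dopM pderXn mul0r add0r /dop dB add0r.
by rewrite [B * 'X]mulrC mulrA -exprSr.
Qed.

Section Commutator.
Variable t : R.
Hypothesis dt1 : d t = 1.

(** The commutator with t is the formal derivative in the operator variable; it lowers degrees in
    [two_sided_small]. *)
Lemma omul_t A : omul A t%:P = t *: A + A^`().
Proof.
have dt i : iter i dop t%:P = t *: 'X^i + 'X^i^`().
  elim: i => [|i IH]; first by rewrite /= expr0 derivC addr0 alg_polyC.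
  rewrite iterS IH raddfD /= dopZ dt1 scale1r derivXn raddfMn /= derivXn /=.
  rewrite /dop pderXn add0r -exprSr mulrS addrA [t *: _ + _]addrC; congr (_ + _).
  by case: i {IH} => [|i]; rewrite ?mulr0n // pderXn add0r -exprSr.
rewrite /omul /act; under eq_bigr => i _ do rewrite dt scalerDr.
have eA : A = \sum_(i < size A) A`_i *: 'X^i by rewrite -poly_def coefK.
rewrite big_split /=; congr (_ + _); rewrite [in RHS]eA.
  by rewrite scaler_sumr; apply: eq_bigr => i _; rewrite !scalerA mulrC.
by rewrite raddf_sum /=; apply: eq_bigr => i _; rewrite linearZ.
Qed.

End Commutator.

Section Char.
Variable p : nat.
Hypothesis pR : p \in [pchar R].
Hypothesis dp0 : forall x, iter p d x = 0.

Let p_pr : prime p := pcharf_prime pR.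
Let polyp (A : {poly R}) : A *+ p = 0.
Proof. by rewrite -mulr_natr pcharf0 ?mulr0 // pchar_poly. Qed.

Lemma iter_pder n A : iter n pder A = \poly_(i < size A) iter n d A`_i.
Proof.
elim: n => [|n IH]; first by rewrite coefK.
apply/polyP=> i; rewrite iterS IH coef_pder !coef_poly.
by case: ifP => //; rewrite raddf0.
Qed.

Lemma iter_pder_p A : iter p pder A = 0.
Proof. by apply/polyP=> i; rewrite iter_pder coef_poly dp0 if_same coef0. Qed.

Lemma iter_dop_p A : iter p dop A = A * 'X^p.
Proof.
rewrite -{1}[A]mulr1 (@leibniz_pchar _ _ _ pder dop dop (fun u v => u * v) dopM) //.
by rewrite iter_pder_p mul0r add0r iter_dop1.
Qed.

(** The coefficients of [a] stand on the left, so only d^p has to pass B, and [iter_dop_p] lets it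
    pass because the derivation has vanishing p-th iterate. *)
Lemma omul_evalp (a B : {poly R}) : omul (a \Po 'X^p) B = (a \Po 'X^p) * B.
Proof.
elim/poly_ind: a B => [|a c IH] B; first by rewrite comp_poly0 /omul act0l mul0r.
rewrite comp_polyD comp_polyM comp_polyX comp_polyC /omul actDl actC.
rewrite mulrDl -mul_polyC; congr (_ + _).
have E : (a \Po 'X^p) * 'X^p = omul (a \Po 'X^p) 'X^p by rewrite omul_hor ?pderXn.
rewrite {1}E (act_omul dopZ) actXn iter_dop_p -/(omul _ _) IH.
by rewrite [B * _]mulrC mulrA.
Qed.

End Char.
End SkewRing.

Section MulD.
Variable F : finFieldType.

(** The sum over k in [mulD] is the Leibniz expansion of d^i B. *)
Lemma mulDE (A B : Dop F) : mulD A B = omul (@dt F) A B.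
Proof.
rewrite /mulD /omul /act; apply: eq_bigr => i _.
rewrite (iter_dop (@dtM F)) scaler_sumr; apply: eq_bigr => k _.
have -> : iter k (pder (@dt F)) B = \sum_(j < size B) iter k (@dt F) B`_j *: 'X^j.
  by rewrite iter_pder poly_def.
rewrite mulr_suml -sumrMnl scaler_sumr; apply: eq_bigr => j _.
rewrite -scalerAl -exprD scalerMnl scalerA [(j + _)%N]addnC.
by congr (_ *: _); rewrite mulr_natr mulrnAl ?mulrnAr.
Qed.

End MulD.

(** * Right division and left ideals over a differential field *)

Section Connection.
Variables (S : comNzRingType) (d : {additive S -> S}) (f : S).

(* The rank one connection on S with connection matrix f; its p-curvature is multiplication by iter p nabla 1. *)
Definition nabla (a : S) : S := d a + f * a.

Lemma nabla_is_zmod_morphism : zmod_morphism nabla.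
Proof. by move=> a b; rewrite /nabla raddfB mulrBr opprD addrACA. Qed.

HB.instance Definition _ :=
  GRing.isZmodMorphism.Build S S nabla nabla_is_zmod_morphism.
End Connection.

Section SkewField.
Variables (E : fieldType) (d : {additive E -> E}).
Hypothesis dM : forall x y, d (x * y) = d x * y + x * d y.
Implicit Types (A B C G L M Q X : {poly E}).

Local Notation "A ** B" := (omul d A B) (at level 40, left associativity).

Lemma omulDl A B C : (A + B) ** C = A ** C + B ** C. Proof. exact: actDl. Qed.
Lemma omulDr A B C : A ** (B + C) = A ** B + A ** C. Proof. exact: actDr. Qed.
Lemma omulBl A B C : (A - B) ** C = A ** C - B ** C. Proof. exact: actBl. Qed.
Lemma omulBr A B C : A ** (B - C) = A ** B - A ** C. Proof. exact: actBr. Qed.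
Lemma omul0l B : 0 ** B = 0. Proof. exact: act0l. Qed.
Lemma omul0r A : A ** 0 = 0. Proof. exact: act0r. Qed.
Lemma omulCl c B : c%:P ** B = c *: B. Proof. exact: actC. Qed.

Lemma size_pder A : (size (pder d A) <= size A)%N.
Proof. exact: size_poly. Qed.

Lemma size_iter_dop n B : B != 0 -> size (iter n (dop d) B) = (n + size B)%N.
Proof.
move=> B0; elim: n => // n IH; rewrite iterS /dop.
have C0 : iter n (dop d) B != 0 by rewrite -size_poly_eq0 IH addn_eq0 size_poly_eq0 (negPf B0) andbF.
move: C0 IH; move: (iter n _ B) => C C0 IH.
by rewrite addrC size_polyDl size_mulX // ?ltnS ?size_pder // IH addSn.
Qed.

Lemma size_omul A B : A != 0 -> B != 0 -> size (A ** B) = (size A + size B).-1.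
Proof.
move=> A0 B0; rewrite /omul /act.
case eA : (size A) => [|n]; first by move/eqP: eA; rewrite size_poly_eq0 (negPf A0).
have an0 : A`_n != 0 by have := lead_coef_eq0 A; rewrite lead_coefE eA (negPf A0) => ->.
rewrite big_ord_recr /= addrC size_polyDl size_scale // size_iter_dop //.
apply: leq_ltn_trans (size_sum _ _ _) _.
have : (0 < size B)%N by rewrite size_poly_gt0.
elim/big_ind: _ => [|x y Hx Hy Bp|i _ Bp]; first by rewrite addn_gt0 orbC => ->.
  by rewrite gtn_max Hx ?Hy.
rewrite (leq_ltn_trans (size_scale_leq _ _)) // size_iter_dop // ltn_add2r //.
Qed.

Lemma size_sub_lead A B : size A = size B -> lead_coef A = lead_coef B ->
  A != 0 -> (size (A - B)%R < size A)%N.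
Proof.
move=> sAB lAB; rewrite -size_poly_gt0; case eA: (size A) => [|n] // _.
rewrite ltnS; apply/leq_sizeP => j; rewrite leq_eqVlt coefB => /predU1P[<-|lt].
  by move: lAB; rewrite !lead_coefE -sAB eA => ->; rewrite subrr.
by rewrite !nth_default ?subrr // -?sAB eA.
Qed.

Lemma oredivp A B : {QR : {poly E} * {poly E} |
  A = QR.1 ** B + QR.2 & (B != 0) ==> (size QR.2 < size B)%N}.
Proof.
have [->|B0] := eqVneq B 0; first by exists (0, A); rewrite //= omul0l add0r.
have [n] := ubnP (size A); elim: n A => // n IH A; rewrite ltnS => sA.
have [lt|ge] := ltnP (size A) (size B).
  by exists (0, A); rewrite //= omul0l add0r.
set k := (size A - size B)%N; set C := iter k (dop d) B.
have sC : size C = size A by rewrite size_iter_dop // subnK.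
have C0 : C != 0 by rewrite -size_poly_gt0 sC (leq_trans _ ge) // size_poly_gt0.
have A0 : A != 0 by rewrite -size_poly_gt0 -sC size_poly_gt0.
have lC0 : lead_coef C != 0 by rewrite lead_coef_eq0.
set c := lead_coef A / lead_coef C.
have c0 : c != 0 by rewrite mulf_neq0 ?invr_eq0 // lead_coef_eq0.
have lt : (size (A - c *: C)%R < n)%N.
  apply: leq_trans sA; apply: size_sub_lead => //; first by rewrite size_scale.
  by rewrite lead_coefZ /c divfK.
have [[Q R] /= e h] := IH _ lt.
exists (Q + c *: 'X^k, R) => //=.
rewrite omulDl omulZl /omul actXn -/C -/(omul d Q B) addrAC -e subrK //.
Qed.

Definition orem B A : {poly E} := (s2val (oredivp A B)).2.

Lemma size_orem B A : B != 0 -> (size (orem B A) < size B)%N.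
Proof. by move=> B0; rewrite /orem; case: oredivp => QR /= _; rewrite B0. Qed.

Definition inL L X := exists Q, X = Q ** L.

Lemma inL_refl L : inL L L. Proof. by exists 1; rewrite omul1l. Qed.
Lemma inL0 L : inL L 0. Proof. by exists 0; rewrite omul0l. Qed.
Lemma inLD L X Y : inL L X -> inL L Y -> inL L (X + Y).
Proof. by move=> [Q ->] [R ->]; exists (Q + R); rewrite omulDl. Qed.
Lemma inLB L X Y : inL L X -> inL L Y -> inL L (X - Y).
Proof. by move=> [Q ->] [R ->]; exists (Q - R); rewrite omulBl. Qed.
Lemma inLM L Q X : inL L X -> inL L (Q ** X).
Proof. by move=> [R ->]; exists (Q ** R); rewrite omulA. Qed.
Lemma inL_trans L M X : inL L M -> inL M X -> inL L X.
Proof. by move=> h [Q ->]; apply: inLM. Qed.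

Lemma inL_size L X : inL L X -> (size X < size L)%N -> X = 0.
Proof.
move=> [Q ->]; have [->|Q0] := eqVneq Q 0; first by rewrite omul0l.
have [->|L0] := eqVneq L 0; first by rewrite omul0r.
rewrite size_omul //; move: Q0 L0; rewrite -!size_poly_gt0; lia.
Qed.

Lemma inL_sub_orem B A : inL B (A - orem B A).
Proof. by rewrite /orem; case: oredivp => -[Q R] /= {1}-> _; exists Q; rewrite addrK. Qed.

Lemma orem_uniq B A R : B != 0 -> inL B (A - R) -> (size R < size B)%N -> orem B A = R.
Proof.
move=> B0 h lt; apply/eqP; rewrite -subr_eq0; apply/eqP.
apply: (@inL_size B).
  have -> : orem B A - R = (A - R) - (A - orem B A) by ring.
  by apply: inLB => //; apply: inL_sub_orem.
by rewrite (leq_ltn_trans (size_polyD _ _)) // size_polyN gtn_max lt size_orem.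
Qed.

Lemma orem_inL B A : B != 0 -> orem B A = 0 <-> inL B A.
Proof.
move=> B0; split=> [e|h].
  by have := inL_sub_orem B A; rewrite e subr0.
by apply: orem_uniq; rewrite ?subr0 ?size_poly0 ?size_poly_gt0.
Qed.

Lemma orem_linear B : B != 0 -> linear (orem B).
Proof.
move=> B0 a u v; apply: orem_uniq => //.
  have -> : a *: u + v - (a *: orem B u + orem B v) =
    a%:P ** (u - orem B u) + (v - orem B v).
    by rewrite omulCl scalerBr; ring.
  by apply: inLD; [apply: inLM|]; apply: inL_sub_orem.
rewrite (leq_ltn_trans (size_polyD _ _)) // gtn_max size_orem // andbT.
by rewrite (leq_ltn_trans (size_scale_leq _ _)) // size_orem.
Qed.

Lemma inL_one L : inL L 1 -> (size L).-1 = 0%N.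
Proof.
move=> h; have [//|lt] := posnP (size L).-1.
suff /eqP : (1 : {poly E}) = 0 by rewrite oner_eq0.
by apply: (inL_size h); rewrite size_poly1; lia.
Qed.

Lemma inL_scale L c : c != 0 -> forall X, inL (c *: L) X <-> inL L X.
Proof.
move=> c0 X; split; apply: inL_trans => //; first by exists c%:P; rewrite omulCl.
by exists (c^-1)%:P; rewrite omulCl scalerA mulVf ?scale1r.
Qed.

Record left_ideal (I : {poly E} -> Prop) : Prop := LeftIdeal {
  left_idealD : forall X Y, I X -> I Y -> I (X + Y);
  left_idealM : forall Q X, I X -> I (Q ** X) }.

Lemma left_idealB I X Y : left_ideal I -> I X -> I Y -> I (X - Y).
Proof.
move=> hI hX hY; have -> : X - Y = X + (-1)%:P ** Y by rewrite omulCl scaleN1r.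
by apply: (left_idealD hI) => //; apply: (left_idealM hI).
Qed.

(** A nonzero element of least size divides all others on the right, since the remainder stays in
    the ideal. *)
Lemma left_ideal_principal I : left_ideal I -> (exists2 X, X != 0 & I X) ->
  exists2 G, G \is monic & forall X, I X <-> inL G X.
Proof.
move=> hI [X0 nz0 I0].
have [G [G0 IG Gmin]] : exists G, [/\ G != 0, I G & forall X, I X -> X != 0 -> (size G <= size X)%N].
  have [n] := ubnP (size X0); elim: n X0 nz0 I0 => // n IH X0 nz0 I0; rewrite ltnS => sX.
  have [[X [IX nzX lt]]|no] := classic (exists X, [/\ I X, X != 0 & (size X < size X0)%N]).
    by apply: (IH X) => //; apply: leq_trans sX.
  exists X0; split=> // X IX nzX; rewrite leqNgt; apply/negP => lt.
  by apply: no; exists X.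
exists ((lead_coef G)^-1 *: G).
  by rewrite monicE lead_coefZ mulVf // lead_coef_eq0.
have c0 : (lead_coef G)^-1 != 0 by rewrite invr_eq0 lead_coef_eq0.
have scal X : inL G X <-> inL ((lead_coef G)^-1 *: G) X.
  split; apply: inL_trans.
    by exists (lead_coef G)%:P; rewrite omulCl scalerA mulfV ?scale1r // lead_coef_eq0.
  by exists ((lead_coef G)^-1)%:P; rewrite omulCl.
move=> X; rewrite -scal; split=> [IX|[Q ->]]; last exact: (left_idealM hI).
apply/(orem_inL _ G0)/eqP; apply: contraT => R0.
have : I (orem G X).
  have -> : orem G X = X - (X - orem G X) by ring.
  apply: left_idealB => //; have [Q ->] := inL_sub_orem G X.
  exact: (left_idealM hI).
by move/Gmin => /(_ R0); rewrite leqNgt size_orem.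
Qed.

(** Polynomials of degree below the order of L form a complement of the left ideal of L, and phi
    restricts to a linear bijection from them. Orders are computed below as dimensions of quotients
    in this way. *)
Lemma ord_eq_dim L n (phi : {poly E} -> 'rV[E]_n) : L != 0 -> linear phi ->
  (forall v, exists X, phi X = v) -> (forall X, phi X = 0 <-> inL L X) ->
  (size L).-1 = n.
Proof.
move=> L0 lin_phi surj ker; pose m := (size L).-1.
have sL : size L = m.+1 by rewrite prednK // size_poly_gt0.
pose f1 := GRing.isLinear.Build E {poly E} 'rV[E]_n _ phi lin_phi.
pose Phi : {linear {poly E} -> 'rV[E]_n} := HB.pack phi f1.
pose g : {linear 'rV[E]_m -> 'rV[E]_n} := Phi \o rVpoly.
have gE (v : 'rV_m) : v *m lin1_mx g = phi (rVpoly v) by rewrite mul_rV_lin1.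
have inj (v : 'rV_m) : v *m lin1_mx g = 0 -> v = 0.
  rewrite gE => /ker h; rewrite -[v]rVpolyK (inL_size h) ?linear0 //.
  by rewrite sL ltnS size_poly.
have surjg (v : 'rV_n) : exists u, u *m lin1_mx g = v.
  have [X <-] := surj v; exists (poly_rV (orem L X)).
  have sR : (size (orem L X) <= m)%N by rewrite -ltnS -sL size_orem.
  rewrite gE poly_rV_K //; have /ker := inL_sub_orem L X.
  rewrite -[phi]/(Phi : _ -> _) linearB /= => /eqP.
  by rewrite subr_eq0 => /eqP ->.
have free : row_free (lin1_mx g).
  by rewrite -kermx_eq0; apply/eqP/row_matrixP => i; rewrite row0; apply: inj; rewrite -row_mul mulmx_ker row0.
have full : row_full (lin1_mx g).
  rewrite -sub1mx; apply/row_subP => i; apply/submxP.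
  by have [u <-] := surjg (row i 1%:M); exists u.
by rewrite -/m -(eqP free) (eqP full).
Qed.

(** * Right divisors of d^p - c: simplicity and factors of order one *)

Section Split.
Variables (p : nat) (t c : E).
Hypothesis pE : p \in [pchar E].
Hypothesis dp0 : forall x, iter p d x = 0.
Hypothesis dt1 : d t = 1.
Hypothesis dc0 : d c = 0.

Let p_pr : prime p := pcharf_prime pE.
Let w : {poly E} := 'X^p - c%:P.

Lemma size_XpsubC : size w = p.+1.
Proof. by rewrite size_XnsubC // prime_gt0. Qed.

Lemma XpsubC_neq0 : w != 0. Proof. by rewrite -size_poly_gt0 size_XpsubC. Qed.

Lemma XpsubC_central A : w ** A = A ** w.
Proof.
rewrite [RHS]omul_hor //; last by rewrite /w raddfB /= pderXn // pderC dc0 subrr.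
have -> : w = ('X - c%:P) \Po 'X^p by rewrite comp_polyB comp_polyX comp_polyC.
by rewrite (omul_evalp dM pE dp0) mulrC.
Qed.

(** Simplicity of D/Dw in terms of representatives. The commutator with t has smaller size, so by
    induction the formal derivative of X vanishes; in degree below p this leaves a constant, which
    would be a unit of J. *)
Lemma two_sided_small J X : left_ideal J -> (forall X Q, J X -> J (X ** Q)) ->
  ~ J 1 -> J X -> (size X <= p)%N -> X = 0.
Proof.
move=> hJ JMr J1; have [n] := ubnP (size X); elim: n X => // n IH X.
rewrite ltnS => sXn JX sXp; have [->//|X0] := eqVneq X 0.
have dX0 : X^`() = 0.
  have lt : (size X^`() < size X)%N by rewrite lt_size_deriv.
  apply: IH; [exact: leq_trans sXn| |exact: leq_trans (ltnW lt) sXp].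
  have -> : X^`() = X ** t%:P - t%:P ** X.
    by rewrite (omul_t dM dt1) omulCl addrC addKr.
  by apply: left_idealB => //; [apply: JMr | apply: (left_idealM hJ)].
have Xc : X = (X`_0)%:P.
  apply/polyP=> -[|i]; rewrite coefC //=.
  have [ge|lt] := leqP (size X) i.+1; first by rewrite nth_default.
  have := congr1 (fun A : {poly E} => A`_i) dX0; rewrite coef_deriv coef0 -mulr_natr.
  move/eqP; rewrite mulf_eq0 => /orP[/eqP //|].
  by rewrite -(dvdn_pcharf pE) gtnNdvd // (leq_trans lt).
case: J1; have -> : 1 = ((X`_0)^-1)%:P ** X.
  rewrite omulCl {2}Xc -mul_polyC -polyCM mulVf //.
  by apply: contraNneq X0 => e; rewrite Xc e.
exact: (left_idealM hJ).
Qed.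

(** A right divisor M of w whose order is a multiple of b and below p gains a left factor of order b
    and remains a right divisor of w. Starting from M = 1, the order climbs in steps of b and must
    end at p. *)
Lemma min_ord_dvd B : inL B w -> (0 < (size B).-1)%N ->
  (forall G, inL G w -> (0 < (size G).-1)%N -> ((size B).-1 <= (size G).-1)%N) ->
  ((size B).-1 %| p)%N.
Proof.
move=> [QB wB] ordB minB; set b := (size B).-1 in ordB minB *.
have B0 : B != 0 by apply: contraTneq ordB => e; rewrite /b e size_poly0.
have B1 : ~ inL B 1.
  move=> h; suff : (1 : {poly E}) = 0 by apply/eqP/oner_neq0.
  by apply: (inL_size h); rewrite size_poly1; move: ordB; rewrite /b; lia.
have wBin A : inL B (w ** A) by rewrite XpsubC_central {1}wB omulA //; exists (A ** QB).
suff H m M : inL M w -> (b %| (size M).-1)%N -> (p - (size M).-1 < m)%N -> (b %| p)%N.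
  apply: (H p.+1 1); rewrite ?size_poly1 //; last by lia.
  by exists w; rewrite omul1r.
elim: m M => // m IH M [QM wM] bM lt.
have M0 : M != 0 by apply: contraNneq XpsubC_neq0 => e; rewrite wM e omul0r.
have QM0 : QM != 0 by apply: contraNneq XpsubC_neq0 => e; rewrite wM e omul0l.
have sM : (size QM + size M = p.+2)%N.
  by have := size_XpsubC; rewrite wM size_omul //; lia.
have [ge|sMp] := leqP p.+1 (size M).
  suff -> : p = (size M).-1 by [].
  by move: QM0; rewrite -size_poly_gt0; lia.
(* The annihilator of D/DB, a proper two-sided ideal; M is too small to lie in it. *)
pose J X := forall x, inL B (X ** x).
have [x Mx] : exists x, ~ inL B (M ** x).
  apply: not_all_ex_not => JM; move/eqP: M0; apply.
  apply: (@two_sided_small J) => //.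
  - split=> [X Y hX hY x|Q X hX x]; first by rewrite omulDl; apply: inLD.
    by rewrite -omulA //; apply: inLM.
  - by move=> X Q hX x; rewrite -omulA.
  - by move=> /(_ 1); rewrite omul1l.
set u := M ** x in Mx.
pose I' X := inL B (X ** u).
have [B' B'm genB'] : exists2 G, G \is monic & forall X, I' X <-> inL G X.
  apply: left_ideal_principal; last by exists w; [exact: XpsubC_neq0 | exact: wBin].
  split=> [X Y hX hY|Q X hX]; rewrite /I'; first by rewrite omulDl; apply: inLD.
  by rewrite -omulA //; apply: inLM.
have B'0 := monic_neq0 B'm.
(* By minimality of b, a generator of DB + Du is 1 or a scalar multiple of B, and the latter would
   put u into DB. *)
have [be [al be1]] : exists be al, 1 = al ** B + be ** u.
  have [G Gm genG] : exists2 G, G \is monic & forall Y, (exists be al, Y = al ** B + be ** u) <-> inL G Y.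
    apply: left_ideal_principal; last first.
      by exists B => //; exists 0, 1; rewrite omul1l omul0l addr0.
    split=> [X Y [b1 [a1 ->]] [b2 [a2 ->]]|Q X [b1 [a1 ->]]].
      by exists (b1 + b2), (a1 + a2); rewrite !omulDl addrACA.
    by exists (Q ** b1), (Q ** a1); rewrite omulDr !omulA.
  have [ga Bga] : inL G B by apply/genG; exists 0, 1; rewrite omul1l omul0l addr0.
  have [G1|] := leqP (size G) 1.
    apply/genG; exists 1; rewrite omul1l.
    by move: Gm; rewrite monicE (size1_polyC G1) lead_coefC => /eqP ->.
  move=> G1; have Gw : inL G w by exists (QB ** ga); rewrite -omulA // -Bga.
  have leBG : (b <= (size G).-1)%N by apply: minB => //; lia.
  have ga0 : ga != 0 by apply: contraNneq B0 => e; rewrite Bga e omul0l.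
  have sga : (size ga <= 1)%N.
    have G0 := monic_neq0 Gm.
    move: (congr1 (fun A : {poly E} => size A) Bga); rewrite size_omul //.
    by move: ordB leBG; rewrite /b; lia.
  have gaC := size1_polyC sga.
  have ga00 : ga`_0 != 0 by apply: contraNneq ga0 => e; rewrite gaC e.
  case: Mx; have [de ude] : inL G u by apply/genG; exists 1, 0; rewrite omul1l omul0l add0r.
  exists (de ** ((ga`_0)^-1)%:P); rewrite ude -omulA //.
  have -> : B = ga`_0 *: G by rewrite Bga {1}gaC omulCl.
  by rewrite omulCl scalerA mulVf // scale1r.
(* X |-> X u is an isomorphism from D/DB' to D/DB: the Bezout relation makes it onto, and B'
   generates its kernel. *)
have ordB' : (size B').-1 = b.
  apply: (@ord_eq_dim _ _ (fun X => poly_rV (orem B (X ** u)))) => //.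
  - move=> a X Y; rewrite omulDl omulZl orem_linear //.
    by rewrite linearP.
  - move=> v; exists (rVpoly v ** be).
    rewrite (@orem_uniq B _ (rVpoly v)) ?rVpolyK //; last first.
      by rewrite (leq_ltn_trans (size_poly _ _)) // /b; move: ordB; rewrite /b; lia.
    exists (-1 *: (rVpoly v ** al)); rewrite omulZl scaleN1r.
    rewrite -{2}[rVpoly v](omul1r dM) be1 omulDr !omulA //.
    by rewrite opprD addrCA subrr addr0.
  - move=> X; rewrite -genB' /I' -orem_inL //; split=> [e|->]; last by rewrite linear0.
    rewrite -(@poly_rV_K _ b (orem B (X ** u))) ?e ?linear0 //.
    by rewrite -ltnS prednK ?size_orem // size_poly_gt0.
(* QM u = w x lies in DB since w is central, so B' splits off QM and B' M still divides w. *)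
have [Q' QMe] : inL B' QM.
  by apply/genB'; rewrite /I' /u omulA // -wM; apply: wBin.
have sM' : size (B' ** M) = (b + size M)%N.
  by rewrite size_omul // -ordB'; move: B'0; rewrite -size_poly_gt0; lia.
have M1 : (0 < size M)%N by rewrite size_poly_gt0.
apply: (IH (B' ** M)).
- by exists Q'; rewrite omulA // -QMe.
- have -> : (size (B' ** M)).-1 = (b + (size M).-1)%N by rewrite sM'; lia.
  by rewrite dvdn_add.
- by rewrite sM'; lia.
Qed.

(** The minimal order divides p and is below p, so it is 1. A divisor of order one is a scalar times
    d - f; it kills 1 in the connection d + f, so w = d^p - c kills 1 as well. *)
Lemma rank_one_connection : (exists G, [/\ inL G w, (0 < (size G).-1)%N & ((size G).-1 < p)%N]) ->
  exists f : E, iter p (nabla d f) 1 = c.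
Proof.
move=> [G0 [G0w G0ord G0p]].
have [B [[Bw ordB] ordBp minB]] : exists B, [/\ inL B w /\ (0 < (size B).-1)%N, ((size B).-1 < p)%N &
    forall G, inL G w -> (0 < (size G).-1)%N -> ((size B).-1 <= (size G).-1)%N].
  have [n] := ubnP (size G0); elim: n G0 G0w G0ord G0p => // n IH G0 G0w G0ord G0p sG0.
  have [[X [X1 X2 X3]]|no] := classic (exists X, [/\ inL X w, (0 < (size X).-1)%N & ((size X).-1 < (size G0).-1)%N]).
    by apply: (IH X) => //; [apply: ltn_trans X3 _ | lia].
  exists G0; split=> // G h1 h2; rewrite leqNgt; apply/negP => lt.
  by apply: no; exists G.
have [_ primeD] := primeP p_pr.
have /primeD /pred2P [b1|bp] := min_ord_dvd Bw ordB minB; last by move: ordBp; rewrite bp ltnn.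
have sB : size B = 2 by move: b1 ordB; lia.
have lB : B`_1 != 0.
  by have := lead_coef_eq0 B; rewrite lead_coefE sB -size_poly_eq0 sB => ->.
pose f := - (B`_0 / B`_1); exists f.
pose D : {additive E^o -> E^o} := nabla d f.
have DZ (a : E) (v : E^o) : D (a *: v) = d a *: v + a *: D v.
  by rewrite /D /= /nabla /GRing.scale /= dM; ring.
have [Q wQ] := Bw.
have aB : act D B 1 = 0.
  rewrite /act sB big_ord_recl big_ord1 /= /bump /= addn0.
  rewrite /nabla /GRing.scale /= der1 // add0r /f; field; exact: lB.
have : act D w 1 = 0 by rewrite wQ act_omul // aB act0r.
rewrite /w actBl actXn actC => /eqP; rewrite subr_eq0 => /eqP.
by rewrite [_ *: _]mulr1.
Qed.

End Split.
End SkewField.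

(** * Divisors of powers of N(d^p) and the Riccati equation *)

(** The section [s] serves to carry the derivation to the quotient and to lift f back from it. *)
Lemma residue_field (K : fieldType) (N : {poly K}) :
  N \is monic -> irreducible_poly N ->
  exists (E : fieldType) (pi : {rmorphism {poly K} -> E}) (s : E -> {poly K}),
    cancel s pi /\ forall a, (pi a == 0) = (N %| a).
Proof.
move=> Nm Ni; have hI : monic_irreducible_poly N by split.
have mkE : mk_monic N = N by rewrite /mk_monic Nm; case: Ni => ->.
pose f0 : {poly K} -> {poly %/ N with hI} := in_qpoly N.
have f0z : zmod_morphism f0 by move=> a b; rewrite /f0 raddfB.
have f0m : monoid_morphism f0 by split; [exact: in_qpoly1 | exact: in_qpolyM].
pose f1 := GRing.isZmodMorphism.Build {poly K} {poly %/ N with hI} f0 f0z.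
pose f2 := GRing.isMonoidMorphism.Build {poly K} {poly %/ N with hI} f0 f0m.
pose pi : {rmorphism {poly K} -> {poly %/ N with hI}} := HB.pack f0 f1 f2.
exists ({poly %/ N with hI} : fieldType), pi, (fun x => (x : {poly %/ N}) : {poly K}).
split=> [x|a].
  by apply: val_inj; exact: (in_qpoly_small (size_mk_monic (x : {poly %/ N}))).
apply/eqP/idP => [/(congr1 val) /= | ].
  by rewrite mkE => /eqP; rewrite -Pdiv.IdomainMonic.modpE.
move=> h; apply: val_inj => /=; rewrite mkE; apply/eqP.
by rewrite -Pdiv.IdomainMonic.modpE.
Qed.

Lemma monic_size1 (R : fieldType) (A : {poly R}) : A \is monic -> (size A).-1 = 0%N -> A = 1.
Proof.
move=> Am sA; have s1 : (size A <= 1)%N by move: sA; lia.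
by move: Am; rewrite monicE (size1_polyC s1) lead_coefC => /eqP ->.
Qed.

Section Power.
Variables (K : fieldType) (d : {additive K -> K}).
Hypothesis dM : forall x y, d (x * y) = d x * y + x * d y.
Variable p : nat.
Hypothesis pK : p \in [pchar K].
Hypothesis dp0 : forall x, iter p d x = 0.
Variable t : K.
Hypothesis dt1 : d t = 1.
Variable N : {poly K}.
Hypothesis Nmonic : N \is monic.
Hypothesis Nirr : irreducible_poly N.
Hypothesis dN : pder d N = 0.

Implicit Types (A B C G L M Q X : {poly K}).
Local Notation "A ** B" := (omul d A B) (at level 40, left associativity).
Local Notation ev := (comp_poly 'X^p : {poly K} -> {poly K}).
Local Notation z := (ev N).

Let p_pr : prime p := pcharf_prime pK.
Let p_gt0 : (0 < p)%N := prime_gt0 p_pr.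

Lemma pder_ev A : pder d (ev A) = ev (pder d A).
Proof.
elim/poly_ind: A => [|A c IH]; first by rewrite comp_poly0 raddf0 comp_poly0.
rewrite comp_polyD comp_polyM comp_polyX comp_polyC !raddfD /= !pderM // !pderC IH.
by rewrite pderX // pderXn // !mulr0 !addr0 comp_polyM comp_polyX comp_polyC.
Qed.

Lemma ev_omul A B : ev A ** B = ev A * B.
Proof. exact: omul_evalp. Qed.

Lemma pder_expn A n : pder d A = 0 -> pder d (A ^+ n) = 0.
Proof.
move=> dA; elim: n => [|n IH]; first by rewrite expr0 pder1.
by rewrite exprS pderM // dA IH mul0r mulr0 addr0.
Qed.

Lemma pder_Nn n : pder d (N ^+ n) = 0. Proof. exact: pder_expn. Qed.

Lemma pder_z : pder d z = 0.
Proof. by rewrite pder_ev dN comp_poly0. Qed.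

Lemma pder_zn n : pder d (z ^+ n) = 0.
Proof. exact/pder_expn/pder_z. Qed.

Lemma omul_zn n A : A ** z ^+ n = A * z ^+ n.
Proof. exact/omul_hor/pder_zn. Qed.

Lemma zn_omul n A : z ^+ n ** A = A * z ^+ n.
Proof. by rewrite -rmorphXn /= ev_omul mulrC. Qed.

Lemma z_neq0 : z != 0.
Proof. by rewrite comp_poly_eq0 ?monic_neq0 // size_polyXn. Qed.

Lemma monic_z : z \is monic.
Proof.
rewrite monicE lead_coef_comp ?size_polyXn // lead_coefXn expr1n mulr1.
by rewrite -monicE.
Qed.

Lemma ord_z : (size z).-1 = ((size N).-1 * p)%N.
Proof. by rewrite size_comp_poly size_polyXn. Qed.

Definition oirreducible M := (0 < (size M).-1)%N /\
  forall A B, M = A ** B -> (size A).-1 = 0%N \/ (size B).-1 = 0%N.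

(* If GCRD(L, z) = 1, say 1 = u L + v z, then L right-divides z^(nu-1) because z is central; otherwise z itself can be split off L. *)
Lemma rdiv_irreducible_pow nu L : oirreducible z -> L \is monic ->
  inL d L (z ^+ nu) -> exists2 m, (m <= nu)%N & L = z ^+ m.
Proof.
move=> [_ zirr]; elim: nu L => [|nu IH] L Lm.
  rewrite expr0 => -[Q QL]; exists 0%N => //; rewrite expr0.
  have L0 := monic_neq0 Lm.
  have Q0 : Q != 0.
    by apply/eqP => e; move/eqP: QL; rewrite e omul0l oner_eq0.
  apply: monic_size1 => //; move: (congr1 (fun A : {poly K} => size A) QL).
  rewrite size_poly1 size_omul //; move: L0 Q0; rewrite -!size_poly_gt0; lia.
move=> [Q zQ].
have [G Gm genG] : exists2 G, G \is monic &
    forall Y, (exists u v, Y = u ** L + v ** z) <-> inL d G Y.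
  apply: left_ideal_principal => //; last first.
    by exists L; [exact: monic_neq0 | exists 1, 0; rewrite omul1l omul0l addr0].
  split=> [X Y [b1 [a1 ->]] [b2 [a2 ->]]|R X [b1 [a1 ->]]].
    by exists (b1 + b2), (a1 + a2); rewrite !omulDl addrACA.
  by exists (R ** b1), (R ** a1); rewrite omulDr !omulA.
have [A zA] : inL d G z by apply/genG; exists 0, 1; rewrite omul1l omul0l add0r.
have [A0|G0] := zirr _ _ zA; last first.
  have [u [v uv]] : exists u v, 1 = u ** L + v ** z.
    by apply/genG; rewrite (monic_size1 Gm G0); exists 1; rewrite omul1r.
  have [|m le Lz] := IH L Lm; last by exists m => //; apply: leqW.
  (* z^nu = z^nu (u L + v z) = z^nu u L + v z^(nu+1), and z^(nu+1) = Q L. *)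
  exists (z ^+ nu ** u + v ** Q).
  rewrite omulDl -!omulA // -zQ -[LHS](omul1r dM) uv omulDr; congr (_ + _).
  by rewrite -[z in v ** z]expr1 !omul_zn zn_omul expr1 exprS mulrA.
(* A is a nonzero scalar, so G and z generate the same left ideal and z divides L on the right. *)
have AC : A = (A`_0)%:P by apply: size1_polyC; move: A0; lia.
have A00 : A`_0 != 0.
  by apply: contraNneq z_neq0 => e; rewrite zA AC e omul0l.
have [D LD] : inL d G L by apply/genG; exists 1, 0; rewrite omul1l omul0l addr0.
pose L' := D ** (A`_0)^-1%:P.
have Lz : L = L' * z.
  rewrite -[z]expr1 -omul_zn expr1 /L' -omulA // zA {2}AC !omulCl scalerA.
  by rewrite mulVf ?scale1r.
have L'm : L' \is monic by rewrite -(monicMr _ monic_z) -Lz.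
have [|m le L'z] := IH L' L'm.
  exists Q; apply: (mulIf z_neq0).
  by rewrite -exprSr zQ Lz -[z in L' * z]expr1 -omul_zn omulA // omul_zn expr1.
by exists m.+1 => //; rewrite Lz L'z exprSr.
Qed.

Definition odecomposable L := exists L1 L2,
  [/\ exists u v, 1 = u ** L1 + v ** L2, (0 < (size L1).-1)%N, (0 < (size L2).-1)%N &
   forall X, (inL d L1 X /\ inL d L2 X) <-> inL d L X].

(** Right divisors of positive order are positive powers of z up to a scalar, so they lie in Dz and
    two of them cannot generate 1. *)
Lemma pow_indecomposable m : oirreducible z -> ~ odecomposable (z ^+ m).
Proof.
move=> zirr [L1 [L2 [[u [v uv]] o1 o2 H]]].
have [h1 h2] : inL d L1 (z ^+ m) /\ inL d L2 (z ^+ m) by apply/H/inL_refl.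
have aux L : (0 < (size L).-1)%N -> inL d L (z ^+ m) -> inL d z L.
  move=> oL hL; have L0 : L != 0 by apply: contraTneq oL => ->; rewrite size_poly0.
  have l0 : (lead_coef L)^-1 != 0 by rewrite invr_eq0 lead_coef_eq0.
  have mL : (lead_coef L)^-1 *: L \is monic by rewrite monicE lead_coefZ mulVf ?lead_coef_eq0.
  have hL' : inL d ((lead_coef L)^-1 *: L) (z ^+ m) by apply/inL_scale.
  have [[|k] _ Lz] := rdiv_irreducible_pow zirr mL hL'.
    by move: (congr1 (fun A : {poly K} => size A) Lz) oL; rewrite size_scale // size_poly1 => ->.
  exists (lead_coef L *: z ^+ k); rewrite -[z in _ ** z]expr1 omul_zn expr1.
  by rewrite -scalerAl -exprSr -Lz scalerA mulfV ?scale1r ?lead_coef_eq0.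
have := zirr.1; rewrite (@inL_one _ d) // uv.
by apply: inLD; apply: inLM => //; apply: aux.
Qed.

(** The p-curvature of the connection d + f on K[Y], a scalar by [iter_nabla_p]; Jacobson's formula
    gives it as f^p + d^(p-1) f. *)
Definition psi (f : {poly K}) : {poly K} := iter p (nabla (pder d) f) 1.

Let polyp (A : {poly K}) : A *+ p = 0.
Proof. by rewrite -mulr_natr pcharf0 ?mulr0 // pchar_poly. Qed.

Lemma nablaM f (a b : {poly K}) : nabla (pder d) f (a * b) = pder d a * b + a * nabla (pder d) f b.
Proof. by rewrite /nabla /= pderM //; ring. Qed.

Lemma iter_nabla_p f a : iter p (nabla (pder d) f) a = a * psi f.
Proof.
rewrite -{1}[a]mulr1.
rewrite (@leibniz_pchar _ _ _ (pder d) (nabla (pder d) f) _ (fun u v => u * v)) //; last exact: nablaM.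
by rewrite iter_pder_p // mul0r add0r.
Qed.

(** The connection d + f + g is the tensor product of d + f and d + g, with 1 = 1 * 1 as its
    generator. *)
Lemma psiD f g : psi (f + g) = psi f + psi g.
Proof.
rewrite /psi -{1}[1]mulr1.
rewrite (@leibniz_pchar _ _ _ (nabla (pder d) f) (nabla (pder d) g) _ (fun u v => u * v)) //.
  by rewrite mulr1 mul1r.
by move=> u v; rewrite /= /nabla /= pderM //; ring.
Qed.

Lemma psi0 : psi 0 = 0.
Proof. by apply: (addrI (psi 0)); rewrite -psiD !addr0. Qed.

Lemma psiN f : psi (- f) = - psi f.
Proof. by apply: (addrI (psi f)); rewrite -psiD !subrr psi0. Qed.

(** nabla commutes with its p-th iterate: nabla (psi f) = nabla^p (nabla 1) = nabla^p f = f psi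
    f. *)
Lemma pder_psi f : pder d (psi f) = 0.
Proof.
have : nabla (pder d) f (psi f) = f * psi f.
  rewrite -[LHS]iterS iterSr iter_nabla_p.
  by rewrite {1}/nabla /= pder1 // add0r mulr1.
by rewrite /nabla => /(canRL (addrK _)); rewrite subrr.
Qed.

(** Modulo e^2 the products inside nabla disappear, and nabla^(n+1) 1 = e d^n h by induction. *)
Lemma psi_infinitesimal (e h : {poly K}) : pder d e = 0 ->
  exists r, psi (e * h) = e * iter p.-1 (pder d) h + e ^+ 2 * r.
Proof.
move=> de; rewrite /psi -(prednK p_gt0).
elim: p.-1 => [|n [r IH]]; first by exists 0; rewrite /= /nabla /= pder1 // add0r !mulr1 mulr0 addr0.
rewrite iterS IH.
exists (pder d r + h * iter n (pder d) h + e * h * r).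
by rewrite /nabla raddfD /= expr2 !pderM // de; ring.
Qed.

Lemma iter_tn n : iter n d (t ^+ n) = n`!%:R.
Proof.
have dtn k : d (t ^+ k.+1) = k.+1%:R * t ^+ k.
  elim: k => [|k IH]; first by rewrite expr1 dt1 mulr1.
  by rewrite exprS dM IH dt1 mul1r -natr1 exprS; ring.
have dn (k : nat) x : d (k%:R * x) = k%:R * d x by rewrite !mulr_natl raddfMn.
have itn m (k : nat) x : iter m d (k%:R * x) = k%:R * iter m d x.
  by elim: m => //= m ->; rewrite dn.
elim: n => [|n IH]; first by rewrite /= expr0.
by rewrite iterSr dtn itn IH factS natrM.
Qed.

Lemma fact_neq0 n : (n < p)%N -> (n`!)%:R != 0 :> K.
Proof.
move=> lt; rewrite -(dvdn_pcharf pK).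
elim: n lt => [|n IH] lt; first by rewrite dvdn1; case: p p_pr => [|[]].
by rewrite factS Euclid_dvdM // negb_or IH ?(ltnW lt) // andbT gtnNdvd.
Qed.

(** An n-fold antiderivative of 1, available only below p: n = p-1 serves [riccati_lift], the
    smaller n serve [cartier_descent]. *)
Lemma iter_tn_div n : (n < p)%N -> iter n d (t ^+ n / n`!%:R) = 1.
Proof.
move=> lt; have f0 := fact_neq0 lt.
have dk : d (n`!%:R) = 0 by rewrite raddfMn /= der1 // mul0rn.
have dc x : d (x / n`!%:R) = d x / n`!%:R.
  apply: (mulIf f0); rewrite [RHS]divfK // -[x in RHS](divfK f0) [in RHS]dM.
  by rewrite dk mulr0 addr0.
have itc k x : iter k d (x / n`!%:R) = iter k d x / n`!%:R.
  by elim: k => //= k ->; rewrite dc.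
by rewrite itc iter_tn mulfV.
Qed.

(* The error term of psi f mod N^n is a constant times N^n, hence killed by a correction N^n h with h^(p-1) prescribed. *)
Lemma riccati_lift f n : (0 < n)%N -> N ^+ n %| psi f - 'X ->
  exists g, N ^+ n.+1 %| psi g - 'X.
Proof.
move=> n0 /dvdpP[e he].
have de : pder d e = 0.
  have := congr1 (pder d) he; rewrite raddfB /= pder_psi pderX // subrr.
  rewrite pderM // pder_Nn mulr0 addr0 => /esym/eqP.
  by rewrite mulf_eq0 expf_eq0 (negPf (monic_neq0 Nmonic)) andbF orbF => /eqP.
pose h := - e * (t ^+ p.-1 / (p.-1)`!%:R)%:P.
have dh : iter p.-1 (pder d) h = - e.
  have H k (c : K) : iter k (pder d) (- e * c%:P) = - e * (iter k d c)%:P.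
    elim: k => //= k ->; rewrite pderM // pderC raddfN /= de oppr0 mul0r add0r //.
  by rewrite /h H iter_tn_div ?prednK // mulr1.
have [r hr] := psi_infinitesimal h (pder_Nn n).
exists (f + N ^+ n * h); rewrite psiD hr dh addrAC he.
have -> : e * N ^+ n + (N ^+ n * - e + (N ^+ n) ^+ 2 * r) = (N ^+ n) ^+ 2 * r by ring.
(* The remaining error is divisible by N^(2n), and 2n >= n+1 as n is positive. *)
by rewrite dvdp_mulr // -exprM dvdp_exp2l // mulnS muln1 -addn1 leq_add2l.
Qed.

(* J is the left ideal of E<D>, E = K[Y]/N, that corresponds to B modulo z; there the question concerns D^p - Y. *)
Lemma riccati_mod : ~ oirreducible z -> exists f, N %| psi f - 'X.
Proof.
move=> zred.
have zpos : (0 < (size z).-1)%N.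
  by rewrite ord_z muln_gt0 p_gt0 andbT; case: Nirr; case: (size N) => [|[]].
have [A [B [zAB A1 B1]]] : exists A B, [/\ z = A ** B, (0 < (size A).-1)%N & (0 < (size B).-1)%N].
  apply: NNPP => no; apply: zred; split=> // A B zAB.
  case: (posnP (size A).-1) => [|a]; first by left.
  case: (posnP (size B).-1) => [|b]; first by right.
  by case: no; exists A, B.
have A0 : A != 0 by apply: contraTneq A1 => ->; rewrite size_poly0.
have B0 : B != 0 by apply: contraTneq B1 => ->; rewrite size_poly0.
have sB : (size B < size z)%N by rewrite zAB size_omul //; move: A1 B1; lia.
have zB : inL d B z by exists A.
have [E [pi [s [sK piE]]]] := residue_field Nmonic Nirr.
pose dE0 x := pi (pder d (s x)).
(* The derivation does not depend on the section: N is constant, so its ideal is stable. *)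
have pid a : pi (pder d a) = dE0 (pi a).
  apply/eqP; rewrite /dE0 -subr_eq0 -rmorphB -raddfB /= piE.
  have : N %| a - s (pi a) by rewrite -piE rmorphB /= sK subrr.
  by move=> /dvdpP[q ->]; rewrite pderM // dN mulr0 addr0 dvdp_mull.
have dE0z : zmod_morphism dE0.
  by move=> x y; rewrite -(sK x) -(sK y) -rmorphB -!pid raddfB rmorphB.
pose f1 := GRing.isZmodMorphism.Build E E dE0 dE0z.
pose dE : {additive E -> E} := HB.pack dE0 f1.
have {}pid a : pi (pder d a) = dE (pi a) := pid a.
have dEM x y : dE (x * y) = dE x * y + x * dE y.
  by rewrite -(sK x) -(sK y) -rmorphM -!pid pderM // rmorphD !rmorphM.
have pE : p \in [pchar E] by apply: (rmorph_pchar pi); rewrite pchar_poly.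
have pid_iter n a : pi (iter n (pder d) a) = iter n dE (pi a).
  by elim: n => //= n <-; rewrite pid.
have dEp x : iter p dE x = 0.
  by rewrite -(sK x) -pid_iter iter_pder_p // rmorph0.
(* [Phi] maps K[Y]<D> to K<d> by D |-> d and Y |-> d^p; it kills D^p - Y and sends N to z. *)
pose Phi (b : {poly {poly K}}) : {poly K} := (map_poly ev b).['X].
have PhiD b c : Phi (b + c) = Phi b + Phi c by rewrite /Phi rmorphD hornerD.
have PhiM b c : Phi (b * c) = Phi b * Phi c by rewrite /Phi rmorphM hornerM.
have PhiC a : Phi a%:P = ev a by rewrite /Phi map_polyC hornerC.
have PhiX : Phi 'X = 'X by rewrite /Phi map_polyX hornerX.
have Phid b : Phi (dop (pder d) b) = dop d (Phi b).
  rewrite /dop PhiD PhiM PhiX; congr (_ + _).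
  elim/poly_ind: b => [|b c IH]; first by rewrite raddf0 -[0]polyC0 PhiC comp_poly0 raddf0.
  rewrite !(PhiD, PhiM, PhiX, PhiC, raddfD) /= !pderM ?PhiD ?PhiM //; last exact: pderM.
  by rewrite IH PhiX (pderX dM) (pderX (pderM dM)) -polyC0 PhiC comp_poly0 !mulr0 !addr0 pderC PhiC pder_ev.
pose J (X : {poly E}) := exists2 b, map_poly pi b = X & inL d B (Phi b).
have JD (X Y : {poly E}) : J X -> J Y -> J (X + Y).
  move=> [b <- hb] [c <- hc]; exists (b + c); rewrite ?rmorphD ?PhiD //.
  exact: inLD.
have JZ x (X : {poly E}) : J X -> J (x *: X).
  move=> [b <- hb]; exists (s x *: b); first by rewrite map_polyZ /= sK.
  by rewrite -mul_polyC PhiM PhiC -ev_omul; apply: inLM.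
have Jdop (X : {poly E}) : J X -> J (dop dE X).
  move=> [b <- hb]; exists (dop (pder d) b).
    rewrite /dop rmorphD rmorphM /= map_polyX; congr (_ + _).
    by apply/polyP=> i; rewrite [RHS]coef_pder !coef_map /= pid.
  rewrite Phid; have -> : dop d (Phi b) = 'X ** Phi b by rewrite /omul -['X]expr1 actXn.
  exact: inLM.
have J0 : J 0 by exists 0; rewrite ?rmorph0 // -[0]polyC0 PhiC comp_poly0; apply: inL0.
have hJ : left_ideal dE J.
  split=> // Q X hX; rewrite /omul /act.
  elim/big_ind: _ => // i _; apply: JZ; elim: (val i) => //= n.
  exact: Jdop.
pose w := 'X^p - (pi 'X)%:P.
have Jw : J w.
  exists ('X^p - 'X%:P).
    by rewrite rmorphB /= map_polyXn map_polyC.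
  have -> : Phi ('X^p - 'X%:P) = 0.
    by rewrite /Phi rmorphB /= map_polyXn map_polyC /= comp_polyX !hornerE subrr.
  exact: inL0.
(* Coefficients divisible by N become a right factor z, so J depends on B only modulo z. *)
have kerpi b : map_poly pi b = 0 -> exists c, Phi b = Phi c * z.
  move=> b0; exists (map_poly (fun a => a %/ N) b); rewrite -PhiC -PhiM.
  congr Phi; apply/polyP=> i; rewrite coefMC coef_map_id0 ?div0p // divpK //.
  by rewrite -piE; have := congr1 (fun q : {poly E} => q`_i) b0; rewrite coef_map coef0 => ->.
have J1 : ~ J 1.
  move=> [b b1 hb].
  have [|c hc] := kerpi (b - 1); first by rewrite rmorphB rmorph1 /= b1 subrr.
  have : inL d B 1.
    have -> : 1 = Phi b - Phi c ** z.
      rewrite -[z in _ ** z]expr1 omul_zn expr1 -hc.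
      have -> : Phi (b - 1) = Phi b - 1 by rewrite /Phi rmorphB rmorph1 hornerD hornerN hornerC.
      by ring.
    by apply: inLB => //; apply: inLM.
  by move=> /inL_one; move: B1; lia.
(* B is rewritten with degree below p in D by replacing D^p by Y. It stays nonzero modulo N because
   B is smaller than z. *)
have [X [X0 JX sX]] : exists X : {poly E}, [/\ X != 0, J X & (size X <= p)%N].
  pose m : {poly {poly K}} := 'X^p - 'X%:P.
  have mm : m \is monic by rewrite monicXnsubC.
  pose b := Pdiv.Ring.rmodp (map_poly (@polyC K) B) m.
  have PhiB : Phi b = B.
    have /(congr1 Phi) := Pdiv.RingMonic.rdivp_eq mm (map_poly (@polyC K) B).
    rewrite PhiD PhiM -/b.
    have -> : Phi m = 0.
      by rewrite /Phi rmorphB /= map_polyXn map_polyC /= comp_polyX !hornerE subrr.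
    rewrite mulr0 add0r => <-; rewrite /Phi -map_poly_comp.
    have -> : map_poly (ev \o polyC) B = map_poly polyC B.
      by apply: eq_map_poly => c /=; rewrite comp_polyC.
    by rewrite -/(comp_poly 'X B) comp_polyXr.
  have sb : (size b <= p)%N.
    have := Pdiv.Ring.ltn_rmodp (map_poly (@polyC K) B) m.
    by rewrite monic_neq0 // size_XnsubC.
  exists (map_poly pi b); split.
  - apply/eqP => /kerpi [c]; rewrite PhiB => Bc.
    have c0 : Phi c != 0 by apply: contraNneq B0 => e; rewrite Bc e mul0r.
    move: sB; rewrite Bc size_mul ?z_neq0 //; move: c0; rewrite -size_poly_gt0.
    by case: (size (Phi c)) => // n _; rewrite addSn /= ltnNge leq_addl.
  - by exists b => //; rewrite PhiB; apply: inL_refl.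
  - exact: leq_trans (size_poly _ _) sb.
have [G Gm genG] : exists2 G : {poly E}, G \is monic & forall Y, J Y <-> inL dE G Y.
  by apply: left_ideal_principal => //; exists X.
have sG : (size G <= p)%N.
  apply: leq_trans sX; have /genG := JX; rewrite leqNgt => h.
  by apply/negP => /(inL_size h)/eqP; apply/negP.
have oG : (0 < (size G).-1)%N.
  rewrite lt0n; apply/eqP => /(monic_size1 Gm) G1.
  apply: J1; apply/genG; rewrite G1; exact: inL_refl.
have [|||f hf] := @rank_one_connection E dE dEM p (pi t%:P) (pi 'X) pE dEp.
- by rewrite -pid pderC dt1 rmorph1.
- by rewrite -pid pderX // rmorph0.
- by exists G; split; [apply/genG | | lia].
exists (s f); rewrite -piE rmorphB /= subr_eq0 -hf; apply/eqP.
rewrite /psi; elim: p => [|n IH]; first by rewrite /= rmorph1.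
by rewrite !iterS -IH /nabla rmorphD rmorphM /= pid sK.
Qed.

Lemma riccati n : ~ oirreducible z -> exists f, N ^+ n %| psi f - 'X.
Proof.
move=> zred; case: n => [|n]; first by exists 0; rewrite expr0 dvd1p.
elim: n => [|n [f IH]]; first by rewrite expr1; apply: riccati_mod.
exact: (riccati_lift _ IH).
Qed.

End Power.

(** * Horizontal generators and the decomposition *)

Section Presentation.
Variables (K : fieldType) (S : comNzRingType) (ev : {rmorphism {poly K} -> S}).
Variable I : S -> Prop.
Hypothesis ID : forall X Y, I X -> I Y -> I (X + Y).
Hypothesis IM : forall a X, I X -> I (ev a * X).
Implicit Types (X Y w : S) (a b c : {poly K}).

Lemma ideal_opp X : I X -> I (- X).
Proof. by move=> h; rewrite -mulN1r -(rmorphN1 ev); apply: IM. Qed.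

Lemma ideal_sub X Y : I X -> I Y -> I (X - Y).
Proof. by move=> hX hY; apply: ID => //; apply: ideal_opp. Qed.

Lemma ideal_congr X Y : I (X - Y) -> I X <-> I Y.
Proof.
move=> h; split=> h'; first by rewrite -(subKr X Y); apply: ideal_sub.
by rewrite -(subrK Y X); apply: ID.
Qed.

(* v induces an isomorphism from the direct sum of the K[Y]/(G i) to S/I. *)
Definition presentation k (G : 'I_k -> {poly K}) (v : 'I_k -> S) :=
  (forall B, exists a : 'I_k -> {poly K}, I (B - \sum_i ev (a i) * v i)) /\
  (forall a : 'I_k -> {poly K}, I (\sum_i ev (a i) * v i) <-> forall i, G i %| a i).

(** The i-th coordinate of w is a unit modulo G_i, so v_i can be recovered from w, while G_i w = 0
    keeps the relations of the same shape. *)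
Lemma presentation_exchange k G v (i : 'I_k) w (a : 'I_k -> {poly K}) :
  presentation G v -> I (w - \sum_l ev (a l) * v l) -> coprimep (a i) (G i) ->
  I (ev (G i) * w) -> presentation G (fun l => if l == i then w else v l).
Proof.
move=> [gen dir] wa /Bezout_eq1_coprimepP[[u u'] /= uu'] Gw.
have sumi (b : 'I_k -> {poly K}) (x : 'I_k -> S) :
  \sum_l ev (b l) * x l = ev (b i) * x i + \sum_(l | l != i) ev (b l) * x l.
  by rewrite (bigD1 i).
have sumv' (b : 'I_k -> {poly K}) :
    \sum_l ev (b l) * (if l == i then w else v l) =
    ev (b i) * w + \sum_(l | l != i) ev (b l) * v l.
  rewrite sumi eqxx; congr (_ + _); apply: eq_bigr => l /negPf ->; by [].
have vi c : G i %| c -> I (ev c * v i).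
  move=> Gc; have := (dir (fun l => if l == i then c else 0)).2.
  rewrite sumi eqxx big1 ?addr0 => [|l /negPf ->]; last by rewrite rmorph0 mul0r.
  by apply=> l; case: eqP => [->|]; rewrite ?dvdp0.
(* The relation G_i w = 0, read in the coordinates of w. *)
have Ga l : G l %| G i * a l.
  have /dir : I (\sum_l ev (G i * a l) * v l) => //.
  have -> : \sum_l ev (G i * a l) * v l = ev (G i) * w - ev (G i) * (w - \sum_l ev (a l) * v l).
    rewrite mulrBr subKr mulr_sumr; apply: eq_bigr => j _; by rewrite rmorphM mulrA.
  by apply: ideal_sub => //; apply: IM.
split=> [B|b].
  have [b hb] := gen B.
  (* Since u a_i = 1 modulo G_i, v_i is u times the difference of w and the sum of a_l v_l over l !=
     i. *)
  exists (fun l => if l == i then u * b i else b l - u * b i * a l).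
  rewrite sumv' eqxx.
  have -> : \sum_(l | l != i) ev (if l == i then u * b i else b l - u * b i * a l) * v l
    = \sum_(l | l != i) ev (b l) * v l - ev (u * b i) * \sum_(l | l != i) ev (a l) * v l.
    rewrite mulr_sumr -sumrB; apply: eq_bigr => l /negPf ->.
    by rewrite rmorphB !rmorphM /=; ring.
  have h1 : I (ev (u' * G i * b i) * v i) by apply: vi; rewrite mulrAC dvdp_mull.
  have e1 : u' * G i * b i = b i - u * a i * b i by rewrite -[b i in X in _ = X - _]mul1r -uu'; ring.
  move: hb wa; rewrite !sumi => hb wa.
  have := ID (ideal_sub hb (IM (u * b i) wa)) h1; rewrite e1.
  set s1 := \sum_(_ | _) _; set s2 := \sum_(_ | _) _.
  congr I; rewrite rmorphB !rmorphM /=; ring.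
rewrite sumv'.
pose c l := if l == i then b i * a i else b l + b i * a l.
have hc : I (ev (b i) * w + \sum_(l | l != i) ev (b l) * v l - \sum_l ev (c l) * v l).
  have -> : ev (b i) * w + \sum_(l | l != i) ev (b l) * v l - \sum_l ev (c l) * v l
    = ev (b i) * (w - \sum_l ev (a l) * v l).
    rewrite !sumi /c eqxx.
    have -> : \sum_(l | l != i) ev (if l == i then b i * a i else b l + b i * a l) * v l
      = \sum_(l | l != i) ev (b l) * v l + ev (b i) * \sum_(l | l != i) ev (a l) * v l.
      rewrite mulr_sumr -big_split; apply: eq_bigr => l /negPf -> /=.
      by rewrite rmorphD !rmorphM /=; ring.
    by rewrite rmorphM; ring.
  exact: IM.
rewrite (ideal_congr hc) dir /c.
have copG : coprimep (G i) (a i).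
  by rewrite coprimep_sym; apply/Bezout_eq1_coprimepP; exists (u, u').
split=> h l.
  have Gbi : G i %| b i by have := h i; rewrite eqxx Gauss_dvdpl.
  have := h l; case: eqP => [->//|_]; rewrite dvdp_addl //.
  by have /dvdpP[q ->] := Gbi; rewrite -mulrA dvdp_mull.
case: eqP => [->|_]; first by rewrite dvdp_mulr.
by rewrite dvdp_addr //; have /dvdpP[q ->] := h i; rewrite -mulrA dvdp_mull.
Qed.

End Presentation.

(** Every nonzero class of K[Y]/N^n has the multiple N^(n-1), so two nonzero submodules always meet.
    Either a factor N is removed from b and n drops, or b is a unit. *)
Lemma irreducible_socle (K : fieldType) (N b : {poly K}) n : irreducible_poly N ->
  ~~ (N ^+ n %| b) -> exists c, N ^+ n %| c * b - N ^+ n.-1.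
Proof.
move=> Ni; elim: n b => [|n IH] b; first by rewrite expr0 dvd1p.
move=> nb; have [|Nb] := boolP (N %| b).
  move=> /dvdpP[b' bE]; case: n IH nb => [|n] IH.
    by rewrite expr1 bE dvdp_mull.
  rewrite bE [b' * N]mulrC exprS dvdp_mul2l; last first.
    by apply/eqP => N0; case: Ni; rewrite N0 size_poly0.
  move=> /IH[c hc]; exists c; rewrite mulrCA /= [in X in _ - X]exprS -mulrBr.
  exact: dvdp_mul.
have : coprimep b (N ^+ n.+1).
  by rewrite coprimep_expr // coprimep_sym irreducible_poly_coprime.
move=> /Bezout_eq1_coprimepP[[u u'] /= e].
exists (N ^+ n * u); rewrite -mulrA.
have -> : N ^+ n * (u * b) - N ^+ n.+1.-1 = - (N ^+ n * u') * N ^+ n.+1.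
  have -> : u * b = 1 - u' * N ^+ n.+1 by rewrite -e; ring.
  by rewrite /=; ring.
exact: dvdp_mull.
Qed.

Section Decomposition.
Variables (K : fieldType) (d : {additive K -> K}).
Hypothesis dM : forall x y, d (x * y) = d x * y + x * d y.
Variable p : nat.
Hypothesis pK : p \in [pchar K].
Hypothesis dp0 : forall x, iter p d x = 0.
Variable t : K.
Hypothesis dt1 : d t = 1.
Variable N : {poly K}.
Hypothesis Nmonic : N \is monic.
Hypothesis Nirr : irreducible_poly N.
Hypothesis dN : pder d N = 0.

Implicit Types (A B C G L M Q X : {poly K}).
Local Notation "A ** B" := (omul d A B) (at level 40, left associativity).
Local Notation ev := (comp_poly 'X^p : {rmorphism {poly K} -> {poly K}}).

Let p_pr : prime p := pcharf_prime pK.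
Let p_gt0 : (0 < p)%N := prime_gt0 p_pr.
Let polyp (A : {poly K}) : A *+ p = 0.
Proof. by rewrite -mulr_natr pcharf0 ?mulr0 // pchar_poly. Qed.

Lemma dop_omul A : dop d A = 'X ** A.
Proof. by rewrite /omul -['X]expr1 actXn. Qed.

Lemma inL_ev L a X : inL d L X -> inL d L (ev a * X).
Proof. by move=> h; rewrite -(ev_omul dM pK dp0); apply: inLM. Qed.

Lemma inL_dop L X : inL d L X -> inL d L (dop d X).
Proof. by rewrite dop_omul; apply: inLM. Qed.

Lemma inLZ L c X : inL d L X -> inL d L (c *: X).
Proof. by move=> h; rewrite -(omulCl d); apply: inLM. Qed.

(* The connection twisted by -f; its kernel will descend to the constants. *)
Definition twist (f X : {poly K}) : {poly K} := dop d X - ev f * X.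

Lemma twist_is_zmod_morphism f : zmod_morphism (twist f).
Proof. by move=> A B; rewrite /twist raddfB mulrBr /=; ring. Qed.

HB.instance Definition _ f :=
  GRing.isZmodMorphism.Build _ _ (twist f) (twist_is_zmod_morphism f).

Lemma twistM f a X : twist f (ev a * X) = ev (pder d a) * X + ev a * twist f X.
Proof. by rewrite /twist /= dopM // (pder_ev dM); ring. Qed.

Lemma twistZ f c X : twist f (c *: X) = d c *: X + c *: twist f X.
Proof.
have := twistM f c%:P X; rewrite pderC /= !comp_polyC.
by rewrite !mul_polyC.
Qed.

(** The twist is the tensor product of d - f with D, so its p-curvature is the sum -psi f + Y. *)
Lemma iter_twist_p f X : iter p (twist f) X = ev ('X - psi d p f) * X.
Proof.
rewrite -{1}[X]mul1r -{1}(rmorph1 ev).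
rewrite (@leibniz_pchar _ _ _ (nabla (pder d) (- f)) (dop d) _ (fun a X => ev a * X)) //.
  rewrite iter_dop_p // -/(psi d p (- f)) psiN // rmorph1 mul1r !raddfB /= raddfN /=.
  by rewrite comp_polyX; ring.
move=> a Y; rewrite /= /twist dopM // (pder_ev dM) /nabla /= comp_polyD comp_polyM.
by rewrite raddfN /=; ring.
Qed.

(* Cartier descent, without choosing coordinates. *)
Lemma cartier_descent f (I W U : {poly K} -> Prop) :
  (forall X Y, I X -> I Y -> I (X + Y)) -> (forall c X, I X -> I (c *: X)) ->
  (forall X, I X -> I (twist f X)) ->
  (forall X Y, W X -> W Y -> W (X + Y)) -> (forall c X, W X -> W (c *: X)) ->
  (forall X, W X -> W (twist f X)) ->
  (forall X Y, U X -> U Y -> U (X + Y)) -> (forall c X, U X -> U (c *: X)) ->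
  (forall X, I X -> U X) ->
  (forall X, W X -> I (twist f X) -> U X) ->
  forall X, W X -> I (iter p (twist f) X) -> U X.
Proof.
move=> ID IZ It WD WZ Wt UD UZ IU WIU X.
(* Induction on the number m <= p of iterates that bring X into I. *)
move: (leqnn p); move: {1 3}p => m.
elim: m X => [|m IH] X lem WX IX; first exact: IU.
pose Y := iter m (twist f) X.
have WY : W Y by rewrite /Y; elim: (m) => //= n; apply: Wt.
have UY : U Y by apply: WIU.
(* As d^m c = 1 and Y is horizontal modulo I, the m-th iterate of c Y is Y modulo I; so X - c Y is
   killed one step earlier. *)
pose c := t ^+ m / m`!%:R.
have cm : iter m d c = 1 := iter_tn_div dM pK dt1 lem.
have -> : X = (X - c *: Y) + c *: Y by rewrite subrK.
apply: UD; last exact: UZ.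
apply: IH; first exact: ltnW.
  by apply: WD => //; rewrite -scaleNr; apply: WZ.
rewrite (iterD_B (twist f)) -/Y.
rewrite (@leibniz _ _ _ d (twist f) _ (fun c X => c *: X)); last exact: twistZ.
rewrite big_ord_recr /= cm subnn binn mulr1n scale1r opprD addrCA subrr addr0.
have I0 : I 0 by rewrite -(scale0r (twist f Y)); apply: IZ.
rewrite -scaleN1r; apply: (IZ); elim/big_ind: _ => // i _.
rewrite -scaler_nat; apply: (IZ); apply: (IZ); rewrite -[(m - i)%N]prednK ?subn_gt0 //.
elim: (m - i).-1 => [|k]; first exact: IX.
exact: It.
Qed.

(** Generators are replaced one by one. In the N^nu_i-torsion W, which horizontal elements span, v_i
    escapes the subspace U where the i-th coordinate is divisible by N; hence a horizontal element
    escapes it too, and exchange applies. *)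
Lemma horizontal_presentation L f n k (nu : 'I_k -> nat) v :
  N ^+ n %| psi d p f - 'X -> inL d L (ev N ^+ n) -> (forall i, (0 < nu i)%N) ->
  presentation ev (inL d L) (fun i => N ^+ nu i) v ->
  exists w, presentation ev (inL d L) (fun i => N ^+ nu i) w /\
    forall i, inL d L (twist f (w i)).
Proof.
move=> Nf Lz nu0 vP.
suff H m : (m <= k)%N -> exists w, presentation ev (inL d L) (fun i => N ^+ nu i) w /\
    forall i : 'I_k, (i < m)%N -> inL d L (twist f (w i)).
  by have [w [h1 h2]] := H k (leqnn k); exists w; split=> // i; apply: h2.
elim: m => [|m IH] lem; first by exists v; split.
have [{vP}v [vP vh]] := IH (ltnW lem).
have [gen dir] := vP.
pose i := Ordinal lem.
pose W X := inL d L (ev (N ^+ nu i) * X).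
pose U X := exists2 a : 'I_k -> {poly K}, inL d L (X - \sum_l ev (a l) * v l) & N %| a i.
have It X : inL d L X -> inL d L (twist f X).
  by move=> h; apply: inLB; [apply: inL_dop | apply: inL_ev].
have [w [Ww hw nUw]] : exists w, [/\ W w, inL d L (twist f w) & ~ U w].
  apply: NNPP => no.
  have UD X Y : U X -> U Y -> U (X + Y).
    move=> [a ha Na] [b hb Nb]; exists (fun l => a l + b l); last exact: dvdp_add.
    have -> : X + Y - \sum_l ev (a l + b l) * v l = (X - \sum_l ev (a l) * v l) + (Y - \sum_l ev (b l) * v l).
      have -> : \sum_l ev (a l + b l) * v l = \sum_l ev (a l) * v l + \sum_l ev (b l) * v l.
        by rewrite -big_split; apply: eq_bigr => l _; rewrite rmorphD mulrDl.
      by ring.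
    exact: inLD.
  have UZ c X : U X -> U (c *: X).
    move=> [a ha Na]; exists (fun l => c *: a l); last by rewrite -mul_polyC dvdp_mull.
    have -> : c *: X - \sum_l ev (c *: a l) * v l = c *: (X - \sum_l ev (a l) * v l).
      rewrite scalerBr scaler_sumr; congr (_ - _); apply: eq_bigr => l _.
      by rewrite /= linearZ /= scalerAl.
    exact: inLZ.
  have IU X : inL d L X -> U X.
    move=> h; exists (fun=> 0); last exact: dvdp0.
    by rewrite big1 ?subr0 // => l _; rewrite rmorph0 mul0r.
  have : U (v i).
    apply: (@cartier_descent f (inL d L) W U) => //.
    - by move=> *; apply: inLD.
    - by move=> *; apply: inLZ.
    - by move=> X Y hX hY; rewrite /W mulrDr; apply: inLD.
    - by move=> c X hX; rewrite /W -scalerAr; apply: inLZ.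
    - move=> X hX; rewrite /W; have := It _ hX; rewrite twistM.
      by rewrite (pder_Nn dM dN) rmorph0 mul0r add0r.
    - by move=> X WX hX; apply: NNPP => nU; apply: no; exists X.
    - have := (dir (fun l => if l == i then N ^+ nu i else 0)).2.
      rewrite (bigD1 i) //= eqxx big1 ?addr0 => [|l /negPf ->]; last by rewrite comp_poly0 mul0r.
      by apply=> l; case: eqP => [->|]; rewrite ?dvdp0.
    (* The p-curvature of the twist is a multiple of z^n, which L divides on the right. *)
    - rewrite iter_twist_p -opprB; have /dvdpP[q ->] := Nf.
      rewrite -mulNr rmorphM rmorphXn mulrAC -(omul_zn dM _ dN).
      exact: inLM.
  move=> [a ha Na].
  have /dir /(_ i) : inL d L (\sum_l ev ((if l == i then 1 else 0) - a l) * v l).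
    move: ha; congr (inL d L _).
    have -> : v i = \sum_l ev (if l == i then 1 else 0) * v l.
      rewrite (bigD1 i) //= eqxx big1 ?addr0 => [|l /negPf ->]; last by rewrite comp_poly0 mul0r.
      by rewrite comp_polyC mul1r.
    by rewrite -sumrB; apply: eq_bigr => l _; rewrite rmorphB mulrBl.
  rewrite eqxx => h; have : N %| 1 - a i.
    by apply: dvdp_trans h; rewrite -(prednK (nu0 i)) exprS dvdp_mulr.
  rewrite dvdp_subl // dvdp1 => /eqP N1.
  by case: Nirr; rewrite N1.
have [a ha] := gen w.
exists (fun l => if l == i then w else v l); split.
  apply: (presentation_exchange _ _ vP ha) => //.
  - by move=> *; apply: inLD.
  - by move=> *; apply: inL_ev.
  - rewrite coprimep_expr // coprimep_sym irreducible_poly_coprime //.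
    by apply/negP => Na; apply: nUw; exists a.
move=> l; rewrite ltnS leq_eqVlt; case: (l =P i) => [->//|ne].
by case/predU1P=> [e|]; [case: ne; apply: val_inj | apply: vh].
Qed.

Section Summands.
Variables (L f : {poly K}) (k : nat) (nu : 'I_k -> nat) (w : 'I_k -> {poly K}).
Hypothesis Lmonic : L \is monic.
Hypothesis nu0 : forall i, (0 < nu i)%N.
Hypothesis wP : presentation ev (inL d L) (fun i => N ^+ nu i) w.
Hypothesis wh : forall i, inL d L (twist f (w i)).

Let nab : {additive {poly K} -> {poly K}} := nabla (pder d) f.

Lemma nabZ c (a : {poly K}) : nab (c *: a) = d c *: a + c *: nab a.
Proof. by rewrite -!mul_polyC -pderC /nab /= (nablaM dM). Qed.

(** Horizontality says d w_i = f w_i modulo DL, so d (a w_i) = (d a + f a) w_i: D acts on K[Y] w_i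
    through the connection d + f on K[Y]. *)
Lemma act_horizontal i X a : inL d L (X ** (ev a * w i) - ev (act nab X a) * w i).
Proof.
have it j : inL d L (iter j (dop d) (ev a * w i) - ev (iter j nab a) * w i).
  elim: j => [|j IH]; first by rewrite subrr; apply: inL0.
  rewrite !iterS; move: (iter j nab a) (iter j (dop d) _) IH => b Y hY.
  have -> : dop d Y - ev (nab b) * w i = dop d (Y - ev b * w i) + ev b * twist f (w i).
    rewrite raddfB /= (dopM dM (_ \Po _)) (pder_ev dM) /nab /= /nabla /twist /=.
    by rewrite comp_polyD comp_polyM; ring.
  by apply: inLD; [apply: inL_dop | apply: inL_ev].
rewrite /omul /act.
have -> : ev (\sum_(j < size X) X`_j *: iter j nab a) * w i =
  \sum_(j < size X) X`_j *: (ev (iter j nab a) * w i).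
  rewrite raddf_sum mulr_suml; apply: eq_bigr => j _.
  by rewrite /= linearZ /= scalerAl.
rewrite -sumrB; elim/big_ind: _ => [|A B|j _]; [exact: inL0 | exact: inLD |].
by rewrite -scalerBr; apply: inLZ.
Qed.

(** X is X applied to 1, so its coordinates are X acting by the connection on those of 1. This
    choice is exactly K-linear, while the other properties hold modulo N^nu_i. *)
Lemma exists_coordinates : exists phi : 'I_k -> {poly K} -> {poly K},
  [/\ forall i, linear (phi i),
      forall X, inL d L X <-> forall i, N ^+ nu i %| phi i X,
      forall b : 'I_k -> {poly K}, exists X, forall i, N ^+ nu i %| phi i X - b i,
      forall i a X, N ^+ nu i %| phi i (ev a * X) - a * phi i X &
      forall i Q X, N ^+ nu i %| phi i X -> N ^+ nu i %| phi i (Q ** X)].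
Proof.
have [gen dir] := wP; have [a ha] := gen 1.
pose phi i X := act nab X (a i).
have expand X : inL d L (X - \sum_i ev (phi i X) * w i).
  have -> : X - \sum_i ev (phi i X) * w i = X ** (1 - \sum_i ev (a i) * w i)
     + \sum_i (X ** (ev (a i) * w i) - ev (phi i X) * w i).
    by rewrite omulBr omul1r // sumrB /omul act_sumr addrA subrK.
  apply: inLD; first exact: inLM.
  by elim/big_ind: _ => [|A B|j _]; [exact: inL0 | exact: inLD | exact: act_horizontal].
have uniq X (b : 'I_k -> {poly K}) : inL d L (X - \sum_i ev (b i) * w i) ->
    forall i, N ^+ nu i %| phi i X - b i.
  move=> h; apply/(dir (fun i => phi i X - b i)).
  have -> : \sum_i ev (phi i X - b i) * w i =
    (X - \sum_i ev (b i) * w i) - (X - \sum_i ev (phi i X) * w i).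
    rewrite opprB addrC addrA subrK -sumrB.
    by apply: eq_bigr => i _; rewrite rmorphB mulrBl.
  exact: inLB.
exists phi; split.
- by move=> i c X Y; rewrite /phi actDl actZl.
- move=> X; rewrite -dir; apply: ideal_congr (expand X).
  + by move=> *; apply: inLD.
  + by move=> *; apply: inL_ev.
- by move=> b; exists (\sum_i ev (b i) * w i); apply: uniq; rewrite subrr; apply: inL0.
- move=> i c X; apply: (uniq (ev c * X) (fun i => c * phi i X)).
  have -> : ev c * X - \sum_i ev (c * phi i X) * w i = ev c * (X - \sum_i ev (phi i X) * w i).
    rewrite mulrBr mulr_sumr; congr (_ - _); apply: eq_bigr => j _.
    by rewrite rmorphM mulrA.
  exact: inL_ev.
move=> i Q X h; rewrite /phi (act_omul nabZ).
(* The ideal of N^nu_i is stable under the connection because N is constant. *)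
have nabN b : N ^+ nu i %| b -> N ^+ nu i %| nab b.
  by move=> /dvdpP[q ->]; rewrite mulrC /nab /= (nablaM dM) (pder_Nn dM dN) mul0r add0r dvdp_mulr.
rewrite {1}/act; elim/big_ind: _ => [|x y|j _]; [exact: dvdp0 | exact: dvdp_add |].
rewrite -mul_polyC dvdp_mull //.
by elim: (val j) => //= n; apply: nabN.
Qed.

Let size_Nn n : (size (N ^+ n)).-1 = (n * (size N).-1)%N.
Proof. by rewrite size_exp mulnC. Qed.

(** L_i generates the kernel of the i-th coordinate, so D/DL_i is K[Y]/N^nu_i and D/DL is their
    direct sum; orders are the K-dimensions. *)
Lemma decomposition : exists Ls : 'I_k -> {poly K},
  [/\ forall X, (forall i, inL d (Ls i) X) <-> inL d L X,
      (size L).-1 = (\sum_(i < k) (size (Ls i)).-1)%N,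
      forall i, (size (Ls i)).-1 = (nu i * (size N).-1)%N &
      forall i, ~ odecomposable d (Ls i)].
Proof.
have [phi [phiL kerL surj phiev phiM]] := exists_coordinates.
have L0 := monic_neq0 Lmonic.
have hex i : exists G, G \is monic /\ forall X, N ^+ nu i %| phi i X <-> inL d G X.
  have [||G Gm GP] := @left_ideal_principal _ d dM (fun X => N ^+ nu i %| phi i X); last by exists G.
    split=> [X Y hX hY|Q X]; last exact: phiM.
    have -> : phi i (X + Y) = phi i X + phi i Y by rewrite -[X]scale1r phiL !scale1r.
    exact: dvdp_add.
  by exists L => //; apply: (kerL L).1 (inL_refl d L) i.
have [Ls LsP] : exists Ls : 'I_k -> {poly K}, forall i, Ls i \is monic /\ forall X, N ^+ nu i %| phi i X <-> inL d (Ls i) X.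
  exact: fin_all_exists hex.
have Nn0 i : N ^+ nu i != 0 by rewrite expf_neq0 // monic_neq0.
have ordLs i : (size (Ls i)).-1 = (nu i * (size N).-1)%N.
  have [Lim LiP] := LsP i.
  apply: (@ord_eq_dim _ d _ _ (fun X => poly_rV (phi i X %% N ^+ nu i))).
  - exact: monic_neq0.
  - by move=> c X Y; rewrite phiL modpD modpZl linearP.
  - move=> v; have [X hX] := surj (fun=> rVpoly v); exists X.
    have := hX i; rewrite /dvdp modpD modpN subr_eq0 => /eqP ->.
    by rewrite modp_small ?rVpolyK // -[X in (_ < X)%N]prednK ?size_poly_gt0 // ltnS size_Nn size_poly.
  move=> X; rewrite -LiP /dvdp; split=> [h|/eqP ->]; last by rewrite linear0.
  rewrite -(@poly_rV_K _ (nu i * (size N).-1)%N (_ %% _)) ?h ?linear0 //.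
  by rewrite -size_Nn -ltnS prednK ?size_poly_gt0 // ltn_modp.
have ordL : (size L).-1 = (\sum_(i < k) (nu i * (size N).-1))%N.
  pose q i := (nu i * (size N).-1)%N.
  apply: (@ord_eq_dim _ d _ _ (fun X => \mxrow_(i < k) (poly_rV (phi i X %% N ^+ nu i) : 'rV_(q i)))) => //.
  - move=> c X Y; apply/mxrowP => i; rewrite submxrowD mxrowK.
    have -> : submxrow (c *: \mxrow_(i < k) (poly_rV (phi i X %% N ^+ nu i) : 'rV_(q i))) i
       = c *: (poly_rV (phi i X %% N ^+ nu i) : 'rV_(q i)).
      by rewrite -[in RHS](mxrowK (fun i => poly_rV (phi i X %% N ^+ nu i) : 'rV_(q i))); apply/matrixP => a b; rewrite !mxE.
    by rewrite mxrowK phiL modpD modpZl linearP.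
  - move=> v; have [X hX] := surj (fun i => rVpoly (submxrow v i : 'rV_(q i))); exists X.
    apply/mxrowP => i; rewrite mxrowK.
    have := hX i; rewrite /dvdp modpD modpN subr_eq0 => /eqP ->.
    by rewrite modp_small ?rVpolyK // -[X in (_ < X)%N]prednK ?size_poly_gt0 // ltnS size_Nn size_poly.
  move=> X; rewrite kerL; split=> [h i|h].
    have := congr1 (fun v => submxrow v i) h; rewrite submxrow0 mxrowK => hi.
    rewrite /dvdp -(@poly_rV_K _ (q i) (_ %% _)) ?hi ?linear0 //.
    by rewrite /q -size_Nn -ltnS prednK ?size_poly_gt0 // ltn_modp.
  by apply/mxrowP => i; rewrite mxrowK submxrow0 (eqP (h i)) linear0.
exists Ls; split=> //.
- move=> X; rewrite kerL; split=> h i; first by apply/(LsP i).2.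
  by apply/(LsP i).2.
- by rewrite ordL; apply: eq_bigr => i _; rewrite ordLs.
move=> i [L1 [L2 [[u [v uv]] o1 o2 H]]].
have [Lim LiP] := LsP i.
(* Outside DL_i every operator has a left multiple whose coordinate generates the socle. *)
have soc A : ~ inL d (Ls i) A -> exists c, N ^+ nu i %| phi i (ev c * A) - N ^+ (nu i).-1.
  move=> nA; have /(irreducible_socle Nirr)[c hc] : ~~ (N ^+ nu i %| phi i A) by apply/negP=> /LiP.
  exists c; have -> : phi i (ev c * A) - N ^+ (nu i).-1 =
    (phi i (ev c * A) - c * phi i A) + (c * phi i A - N ^+ (nu i).-1) by ring.
  by apply: dvdp_add.
have H1 := fun X h => ((H X).2 h).1; have H2 := fun X h => ((H X).2 h).2.
(* In this case L1 lies in DL_i, hence in DL2, and coprimality forces L2 to have order 0. *)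
have [h1|n1] := classic (inL d (Ls i) L1).
  suff /inL_one e : inL d L2 1 by rewrite e in o2.
  rewrite uv; apply: inLD; apply: inLM => //; [exact: H2 | exact: inL_refl].
have [h2|n2] := classic (inL d (Ls i) L2).
  suff /inL_one e : inL d L1 1 by rewrite e in o1.
  rewrite uv; apply: inLD; apply: inLM => //; [exact: inL_refl | exact: H1].
have [c1 hc1] := soc _ n1; have [c2 hc2] := soc _ n2.
have X1 : inL d L1 (ev c1 * L1) by apply/inL_ev/inL_refl.
have X2 : inL d L2 (ev c2 * L2) by apply/inL_ev/inL_refl.
have phiB X Y : phi i (X - Y) = phi i X - phi i Y.
  by rewrite addrC -scaleN1r phiL scaleN1r addrC.
(* Both multiples have coordinate N^(nu_i - 1), so they agree modulo DL_i. Then c1 L1 lies in both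
   ideals, hence in DL_i, although N^nu_i does not divide N^(nu_i - 1). *)
have X12 : inL d (Ls i) (ev c1 * L1 - ev c2 * L2).
  apply/LiP; rewrite phiB.
  have -> : phi i (ev c1 * L1) - phi i (ev c2 * L2) =
    (phi i (ev c1 * L1) - N ^+ (nu i).-1) - (phi i (ev c2 * L2) - N ^+ (nu i).-1) by ring.
  exact: dvdp_sub.
have /LiP : inL d (Ls i) (ev c1 * L1).
  apply/H; split=> //.
  have -> : ev c1 * L1 = (ev c1 * L1 - ev c2 * L2) + ev c2 * L2 by ring.
  by apply: inLD => //; apply: H2.
rewrite -(dvdp_subl _ hc1) subKr.
move=> /dvdp_leq; rewrite expf_neq0 ?monic_neq0 // => /(_ isT).
rewrite leqNgt => /negP; apply.
rewrite -[X in (X < _)%N]prednK ?size_poly_gt0 ?expf_neq0 ?monic_neq0 // size_Nn.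
rewrite -[X in (_ < X)%N]prednK ?size_poly_gt0 // size_Nn ltnS ltn_pmul2r ?prednK //.
by case: Nirr; case: (size N) => [|[]].
Qed.

End Summands.
End Decomposition.

(** * Comparison with the operators over F_q(t) *)

Section Bridge.
Variable F : finFieldType.
Implicit Types (A B L M X : Dop F).

Lemma inLidealE L X : inLideal L X <-> inL (@dt F) L X.
Proof. by split=> -[Q QL]; exists Q; rewrite QL mulDE. Qed.

Lemma irreducibleDE M : irreducibleD M <-> oirreducible (@dt F) M.
Proof.
split=> -[M0 irr]; split=> // A B; first by rewrite -mulDE; apply: irr.
by rewrite mulDE; apply: irr.
Qed.

Lemma decomposable_odecomposable L : decomposable L -> odecomposable (@dt F) L.
Proof.
move=> [L1 [L2 [cop o1 o2 lclm]]]; exists L1, L2; split=> //.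
  have [|u [v uv]] := (cop 1).2; first by exists 1; rewrite mulDE omul1l.
  by exists u, v; rewrite uv !mulDE.
move=> X; rewrite -!inLidealE -lclm; split=> [[h1 h2] i|h].
  by case: ifP.
by split; [have := h ord0 | have := h (lift ord0 ord0)].
Qed.

Lemma expDE A n : pder (@dt F) A = 0 -> expD A n = A ^+ n.
Proof.
move=> dA; elim: n => [|n IH]; first by rewrite expr0; exact: erefl.
have -> : expD A n.+1 = mulD A (expD A n) by exact: erefl.
rewrite IH mulDE exprS.
exact: (omul_hor (@dtM F) A (pder_expn (@dtM F) n dA)).
Qed.

Lemma mulD_evalDp p (a B : {poly Kt F}) : p \in [pchar F] ->
  mulD (evalDp p a) B = (a \Po 'X^p) * B.
Proof.
move=> Hp; rewrite mulDE /evalDp.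
exact: (omul_evalp (@dtM F) (pchar_Kt Hp) (iter_dt_p Hp)).
Qed.

End Bridge.

(* N lives in F_q(s)[Y] with s = t^p; its image in F_q(t)[Y] is
   map_poly (frobT p) N, and N(d^p) = evalDp p (map_poly (frobT p) N). *)
Theorem mainTheorem5 (F : finFieldType) (p : nat) (Hp : p \in [pchar F])
  (N : {poly Kt F}) (HNmon : N \is monic) (HNirr : irreducible_poly N)
  (HNsep : separable_poly N) (nu : nat) (L : Dop F)
  (HLmon : L \is monic)
  (HLdiv : rdvd L (expD (evalDp p (map_poly (frobT p) N)) nu)) :
  let NDp := evalDp p (map_poly (frobT p) N) in
  (irreducibleD NDp ->
     (exists2 m : nat, (m <= nu)%N & L = expD NDp m) /\ indecomposable L) /\
  (~ irreducibleD NDp ->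
     forall (k : nat) (nus : 'I_k -> nat),
       frob_invariants p L (fun i => map_poly (frobT p) (N ^+ nus i)) ->
       exists Ls : 'I_k -> Dop F,
         [/\ is_LCLM L Ls /\ ord L = (\sum_(i < k) ord (Ls i))%N,
             forall i, ord (Ls i) = (nus i * (size N).-1)%N &
             forall i, indecomposable (Ls i)]).
Proof.
have [M [Mmon Mirr dM sM ME]] := frobT_poly Hp HNmon HNirr HNsep.
have {}dM : pder (@dt F) M = 0 := dM.
have ME1 : map_poly (frobT p) N = M by have := ME 1%N; rewrite !expr1.
have dMul := @dtM F; have pK := pchar_Kt Hp; have dp0 := iter_dt_p Hp.
have dt1 := dtX F.
move=> NDp; have NDpE : NDp = M \Po 'X^p by rewrite /NDp ME1.
rewrite -/NDp in HLdiv; move: NDp NDpE HLdiv => _ -> HLdiv.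
set NDp := M \Po 'X^p in HLdiv *.
have hz : pder (@dt F) NDp = 0 by rewrite /NDp (pder_ev dMul) dM comp_poly0.
have zE n : expD NDp n = NDp ^+ n := expDE n hz.
have Lz : inL (@dt F) L (NDp ^+ nu) by rewrite -zE; apply/inLidealE.
split=> [/irreducibleDE zirr | zred k nus].
  have [m le Lm] := rdiv_irreducible_pow dMul pK dp0 Mmon dM zirr HLmon Lz.
  split; first by exists m; rewrite ?zE.
  move=> /decomposable_odecomposable; rewrite Lm.
  exact: (pow_indecomposable dMul pK dp0 Mmon dM zirr).
have {}zred : ~ oirreducible (@dt F) NDp by move=> h; apply: zred; apply/irreducibleDE.
move=> [_ nus1 _ [v [gen dir]]].
have nu0 i : (0 < nus i)%N.
  by have := nus1 i; rewrite ME; case: (nus i) => //; rewrite expr0 size_poly1.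
have vP : presentation (comp_poly 'X^p : {rmorphism {poly Kt F} -> {poly Kt F}})
    (inL (@dt F) L) (fun i => M ^+ nus i) v.
  have sumE (a : 'I_k -> {poly Kt F}) : \sum_i mulD (evalDp p (a i)) (v i) = \sum_i (a i \Po 'X^p) * v i.
    by apply: eq_bigr => i _; rewrite mulD_evalDp.
  split=> [B|a].
    by have [a /inLidealE] := gen B; rewrite sumE => h; exists a.
  have := dir a; rewrite sumE inLidealE => ->.
  by split=> h i; have := h i; rewrite ME.
(* The exponent nu is the one with L dividing z^nu, so the twisted p-curvature vanishes on all of
   D/DL. *)
have [f Mf] := riccati dMul pK dp0 dt1 Mmon Mirr dM nu zred.
have [w [wP wh]] := horizontal_presentation dMul pK dp0 dt1 Mirr dM Mf Lz nu0 vP.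
have [Ls [lclm oL oLs ind]] := decomposition dMul pK dp0 Mmon Mirr dM HLmon nu0 wP wh.
exists Ls; split.
- split=> // X; rewrite inLidealE -lclm.
  by split=> h i; apply/inLidealE.
- by move=> i; rewrite -sM; apply: oLs.
- by move=> i /decomposable_odecomposable; apply: ind.
Qed.
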